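(* Let $\Delta \geq 4$ be an integer. If $G$ is a planar graph with maximum degree at most $\Delta$ and girth at least $10\Delta - 4$, then $G$ has a strong edge coloring with $2\Delta - 1$ colors.
   Context: All graphs are simple, finite and undirected. A strong edge coloring of a graph is a proper edge coloring in which every color class is an induced matching. The girth of a graph is the length of a shortest cycle (infinite if the graph has no cycle). *)

(* Defs.v *)
From HB Require Import structures.
From mathcomp Require Import all_boot all_order all_algebra.
From mathcomp Require Import all_classical all_reals all_analysis.
Import Order.TTheory GRing.Theory Num.Theory.
Import numFieldNormedType.Exports.

Set Implicit Arguments.
Unset Strict Implicit.
Unset Printing Implicit Defensive.

Record sgraph := SGraph {
  vertex :> finType;
  adj : rel vertex;
  adj_sym : symmetric adj;
  adj_irr : irreflexive adj }.

Section Combinatorics.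
Local Open Scope set_scope.
Variable G : sgraph.

Definition neighbours (x : G) : {set G} := [set y | adj x y].

Definition max_degree : nat := \max_(x : G) #|neighbours x|.

(* An edge is the unordered pair of its endpoints. *)
Definition edges : {set {set G}} :=
  [set f : {set G} | [exists x, exists y, adj x y && (f == [set x; y])]].

(* The size condition excludes the closed walks x, y, x, which are simple
   cycles in the sense of [ucycle]. *)
Definition graph_cycle (s : seq G) : Prop := 2 < size s /\ ucycle (@adj G) s.

Definition matching (M : {set {set G}}) : Prop :=
  M \subset edges /\ finset.trivIset M.

(* [cover M] is the set of endpoints of M, so the last clause says that the
   subgraph induced by these endpoints has no edge outside M. *)
Definition induced_matching (M : {set {set G}}) : Prop :=
  matching M /\ forall f, f \in edges -> f \subset finset.cover M -> f \in M.

(* Colors given to sets of vertices that are not edges are irrelevant. *)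
Definition proper_edge_coloring (k : nat) (c : {set G} -> 'I_k) : Prop :=
  forall f1 f2, f1 \in edges -> f2 \in edges -> f1 != f2 ->
    ~~ [disjoint f1 & f2] -> c f1 != c f2.

Definition strong_edge_coloring (k : nat) (c : {set G} -> 'I_k) : Prop :=
  proper_edge_coloring c /\
  forall i : 'I_k, induced_matching [set f in edges | c f == i].

End Combinatorics.

Section Analysis.
Local Open Scope ring_scope.
Local Open Scope classical_set_scope.
Variables (R : realType) (G : sgraph).

(* The infimum of the empty set is +oo. *)
Definition girth : \bar R :=
  ereal_inf [set ((size s)%:R)%:E | s in @graph_cycle G].

(* Vertices are distinct points of the plane; an edge f is the arc
   gamma f @` `[0, 1], joining the two points that represent its ends. *)
Record plane_drawing (p : G -> R * R) (gamma : {set G} -> R -> R * R) : Prop :=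
  PlaneDrawing {
    drawing_vertex_inj : injective p;
    drawing_arc_continuous : forall f, f \in edges G ->
      {within `[0, 1], continuous (gamma f)};
    drawing_arc_inj : forall f, f \in edges G ->
      {in `[0, 1] &, injective (gamma f)};
    drawing_arc_ends : forall f, f \in edges G ->
      [set gamma f 0; gamma f 1] = p @` [set` f];
    drawing_arc_vertex : forall f, f \in edges G ->
      gamma f @` `]0, 1[ `&` range p = set0;
    drawing_arc_arc : forall f1 f2, f1 \in edges G -> f2 \in edges G ->
      f1 != f2 -> gamma f1 @` `]0, 1[ `&` gamma f2 @` `]0, 1[ = set0 }.

Definition planar : Prop := exists p gamma, plane_drawing p gamma.

End Analysis.

(* Main.v *)
(* A map sending each vertex to a (Delta - 1)-subset of the 2 Delta - 1 colours,
   so that adjacent vertices get disjoint sets and the neighbours of a vertex get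
   distinct sets (a locally injective homomorphism to the odd graph), yields a
   strong edge coloring: colour xy by the unique element outside the sets of x
   and y.  Such a map extends over a pendant vertex, and over a path of
   2 Delta - 1 consecutive vertices of degree 2, because any two vertices of the
   odd graph are joined by a non-backtracking walk of length 2 Delta with
   prescribed first and last steps.

   In a planar graph of girth at least 10 Delta - 4 and minimum degree 2, such a
   path exists.  Arcs are replaced by polygons, straight near their ends, that
   cross themselves at most.  To each corner at a vertex we attach the functional
   on the cycle space mod 2 that gives the parity of the crossings of a vertical
   ray from a point of the corner.  Corners separated by the edge xy at x have
   functionals that differ by the coordinate of xy, and the two functionals on
   the sides of xy at x are those at y.  Hence the functionals span the dual of
   the cycle space, and there are at least m - n + 1 of them; on the other hand
   the vertices that see a given functional contain a cycle.  If every cycle had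
   at least six vertices of degree at least 3, counting corners at these vertices
   would contradict the handshake lemma; so some cycle has at most five, and it
   contains the path by the pigeonhole principle. *)
Require Import Defs.
From HB Require Import structures.
From mathcomp Require Import all_boot all_order all_algebra.
From mathcomp Require Import zify ring lra.

Set Implicit Arguments.
Unset Strict Implicit.
Unset Printing Implicit Defensive.
Import Order.TTheory GRing.Theory Num.Theory.

(** * Ray parity of segments and polygons *)

Section RayParity.
Local Open Scope ring_scope.
Variable R : realFieldType.
Implicit Types (a b c z o : R * R) (k l : seq (R * R)).

Definition seg_pt a b (t : R) : R * R :=
  (a.1 + t * (b.1 - a.1), a.2 + t * (b.2 - a.2)).

Definition meets a b z z' : Prop := exists s t,
  [/\ 0 <= s <= 1, 0 <= t <= 1 & seg_pt a b s = seg_pt z z' t].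

(** The value on a vertical segment is irrelevant: there the first conjunct of [below] and [above]
    already fails. *)
Definition height a b (x : R) := a.2 + (b.2 - a.2) * ((x - a.1) / (b.1 - a.1)).

(* Points on the same vertical line count as lying on the same side of it: this
   is what makes the ray parity of a closed polygon correct without any
   genericity assumption. *)
Definition below z a b : bool :=
  ((a.1 <= z.1) != (b.1 <= z.1)) && (z.2 < height a b z.1).

(** Membership of a in the region bounded below by z z' and on the sides by the upward rays from its
    ends. *)
Definition above a z z' : bool :=
  ((a.1 <= z.1) != (a.1 <= z'.1)) && (height z z' a.1 < a.2).

Lemma heightC a b x : a.1 != b.1 -> height a b x = height b a x.
Proof.
move=> ab; rewrite /height.
have h1 : b.1 - a.1 != 0 by rewrite subr_eq0 eq_sym.
have h2 : a.1 - b.1 != 0 by rewrite subr_eq0.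
by field; rewrite h1 h2.
Qed.

Lemma belowC z a b : below z a b = below z b a.
Proof.
rewrite /below eq_sym; case: (eqVneq a.1 b.1) => [->|ab]; first by rewrite eqxx.
by rewrite (heightC _ ab).
Qed.

Lemma aboveC a z z' : above a z z' = above a z' z.
Proof.
rewrite /above eq_sym; case: (eqVneq z.1 z'.1) => [->|ab]; first by rewrite eqxx.
by rewrite (heightC _ ab).
Qed.

Lemma meetsC a b z z' : meets a b z z' -> meets z z' a b.
Proof. by move=> [s [t [hs ht e]]]; exists t, s. Qed.

Lemma meets_revl a b z z' : meets a b z z' -> meets b a z z'.
Proof.
move=> [s [t [/andP[s0 s1] ht e]]]; exists (1 - s), t.
split=> //; first by apply/andP; split; lra.
by rewrite -e /seg_pt; congr pair; ring.
Qed.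

Lemma meets_revr a b z z' : meets a b z z' -> meets a b z' z.
Proof. by move=> /meetsC /meets_revl /meetsC. Qed.

Lemma seg_pt_comb a b s t u :
  seg_pt (seg_pt a b s) (seg_pt a b t) u = seg_pt a b ((1 - u) * s + u * t).
Proof. by rewrite /seg_pt /=; congr pair; ring. Qed.

(* Intermediate value theorem for the vertical gap between the two lines. *)
Lemma meets_of_gap a b z z' s s' t t' :
  0 <= s <= 1 -> 0 <= s' <= 1 -> 0 <= t <= 1 -> 0 <= t' <= 1 ->
  (seg_pt a b s).1 = (seg_pt z z' t).1 ->
  (seg_pt a b s').1 = (seg_pt z z' t').1 ->
  (seg_pt z z' t).2 < (seg_pt a b s).2 ->
  (seg_pt a b s').2 <= (seg_pt z z' t').2 ->
  meets a b z z'.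
Proof.
move=> hs hs' ht ht' e e' g g'.
pose D := (seg_pt a b s).2 - (seg_pt z z' t).2.
pose D' := (seg_pt z z' t').2 - (seg_pt a b s').2.
have D0 : 0 < D by rewrite /D; lra.
have D'0 : 0 <= D' by rewrite /D'; lra.
pose u := D / (D + D').
have S0 : 0 < D + D' by lra.
have u0 : 0 <= u by rewrite divr_ge0 // ltW.
have u1 : u <= 1 by rewrite ler_pdivrMr // mul1r; lra.
have hu : u * (D + D') = D by rewrite /u divfK // gt_eqF.
have conv x y : 0 <= x <= 1 -> 0 <= y <= 1 -> 0 <= (1 - u) * x + u * y <= 1.
  by move=> /andP[x0 x1] /andP[y0 y1]; apply/andP; split; nra.
exists ((1 - u) * s + u * s'), ((1 - u) * t + u * t').
split; [exact: conv | exact: conv |].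
rewrite -!seg_pt_comb.
move: e e' hu; rewrite /D /D'.
move: (seg_pt a b s) (seg_pt a b s') (seg_pt z z' t) (seg_pt z z' t').
move=> [p1 p2] [p1' p2'] [q1 q2] [q1' q2'] /= -> -> hu.
by rewrite /seg_pt /=; congr pair; lra.
Qed.

Lemma height_seg_pt a b x : a.1 != b.1 ->
  seg_pt a b ((x - a.1) / (b.1 - a.1)) = (x, height a b x).
Proof.
move=> ab; rewrite /seg_pt /height; congr pair; last by ring.
by rewrite divfK ?subr_eq0 1?eq_sym //; ring.
Qed.

Lemma itv_param (a b x : R) : a < b -> a <= x <= b -> 0 <= (x - a) / (b - a) <= 1.
Proof.
move=> ab /andP[ax xb]; have d0 : 0 < b - a by lra.
apply/andP; split; first by apply: divr_ge0; lra.
by rewrite ler_pdivrMr // mul1r; lra.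
Qed.

Lemma seg_pt0 a b : seg_pt a b 0 = a.
Proof. by case: a => ? ?; rewrite /seg_pt /=; congr pair; ring. Qed.

Lemma seg_pt1 a b : seg_pt a b 1 = b.
Proof. by case: b => ? ?; rewrite /seg_pt /=; congr pair; ring. Qed.

Lemma on_seg a b x : a.1 < b.1 -> a.1 <= x -> x <= b.1 ->
  exists2 s, 0 <= s <= 1 & seg_pt a b s = (x, height a b x).
Proof.
move=> ab ax xb; exists ((x - a.1) / (b.1 - a.1)).
  by apply: itv_param; rewrite ?ax.
by rewrite height_seg_pt // lt_eqF.
Qed.

Lemma meets_of_gaps a b z z' (x x' y1 y2 y1' y2' : R) s s' t t' :
  0 <= s <= 1 -> 0 <= s' <= 1 -> 0 <= t <= 1 -> 0 <= t' <= 1 ->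
  seg_pt a b s = (x, y1) -> seg_pt z z' t = (x, y2) ->
  seg_pt a b s' = (x', y1') -> seg_pt z z' t' = (x', y2') ->
  ~ meets a b z z' -> (y2 < y1) = (y2' < y1').
Proof.
move=> hs hs' ht ht' e1 e2 e1' e2' nm; apply/idP/idP => h.
  case: ltP => // h'; case: nm.
  by apply: (@meets_of_gap a b z z' s s' t t') => //; rewrite ?e1 ?e2 ?e1' ?e2'.
case: ltP => // h'; case: nm.
by apply: (@meets_of_gap a b z z' s' s t' t) => //; rewrite ?e1 ?e2 ?e1' ?e2'.
Qed.

(* The closed curve formed by the segment z z' and the vertical rays up from its
   ends is crossed by a segment disjoint from z z' only along the rays. *)
Lemma seg_parity a b z z' : ~ meets a b z z' ->
  below z a b (+) below z' a b = above a z z' (+) above b z z'.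
Proof.
wlog ab : a b / a.1 <= b.1.
  move=> W nm; case: (leP a.1 b.1) => [|/ltW] h; first exact: W.
  rewrite belowC [below z' _ _]belowC addbC [RHS]addbC [LHS]addbC; apply: W => //.
  by move=> /meets_revl.
wlog zz : z z' / z.1 <= z'.1.
  move=> W nm; case: (leP z.1 z'.1) => [|/ltW] h; first exact: W.
  rewrite aboveC [above b _ _]aboveC [LHS]addbC; apply: W => //.
  by move=> /meets_revr.
have i0 : 0 <= (0:R) <= 1 by rewrite lexx ler01.
have i1 : 0 <= (1:R) <= 1 by rewrite lexx ler01.
move=> nm; rewrite /below /above.
(* In the four relative positions left, the projections to the x-axis overlap, and [meets_of_gaps]
   equates the sign of the vertical gap at the two ends of the overlap. *)
have [az|az] := leP a.1 z.1; have [bz|bz] := leP b.1 z.1;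
have [az'|az'] := leP a.1 z'.1; have [bz'|bz'] := leP b.1 z'.1 => //=; try lra.
- rewrite addbF.
  case: (@on_seg a b z.1); [lra|lra|lra|move=> s hs es].
  case: (@on_seg z z' b.1); [lra|lra|lra|move=> t ht et].
  apply: (@meets_of_gaps a b z z' z.1 b.1 _ _ _ _ s 1 0 t) => //; rewrite ?seg_pt0 ?seg_pt1 //.
  + by case: (z).
  + by case: (b).
- case: (@on_seg a b z.1); [lra|lra|lra|move=> s hs es].
  case: (@on_seg a b z'.1); [lra|lra|lra|move=> s' hs' es'].
  apply/eqP; rewrite -[_ == _]negb_add addbF negb_add; apply/eqP.
  apply: (@meets_of_gaps a b z z' z.1 z'.1 _ _ _ _ s s' 0 1) => //; rewrite ?seg_pt0 ?seg_pt1 //.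
  + by case: (z).
  + by case: (z').
- case: (@on_seg z z' a.1); [lra|lra|lra|move=> t ht et].
  case: (@on_seg z z' b.1); [lra|lra|lra|move=> t' ht' et'].
  apply/esym/eqP; rewrite -[_ == _]negb_add addbF negb_add; apply/eqP.
  apply: (@meets_of_gaps a b z z' a.1 b.1 _ _ _ _ 0 1 t t') => //; rewrite ?seg_pt0 ?seg_pt1 //.
  + by case: (a).
  + by case: (b).
- rewrite addbF.
  case: (@on_seg a b z'.1); [lra|lra|lra|move=> s hs es].
  case: (@on_seg z z' a.1); [lra|lra|lra|move=> t ht et].
  apply: (@meets_of_gaps a b z z' z'.1 a.1 _ _ _ _ s 0 1 t) => //; rewrite ?seg_pt0 ?seg_pt1 //.
  + by case: (z').
  + by case: (a).
Qed.

End RayParity.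

Section Polygons.
Local Open Scope ring_scope.
Variable R : realFieldType.
Implicit Types (a b c z o u v : R * R) (k l : seq (R * R)).

Definition sides a l := zip (a :: l) l.

Fixpoint ray_parity z a l : bool :=
  if l is b :: l' then below z a b (+) ray_parity z b l' else false.

Fixpoint aboves u z k : bool :=
  if k is z' :: k' then above u z z' (+) aboves u z' k' else false.

(** Summing [seg_parity] over the sides counts every intermediate vertex twice, so only the two ends
    survive. *)
Lemma ray_parity_step z z' a l :
    (forall u v, (u, v) \in sides a l -> ~ meets u v z z') ->
  ray_parity z a l (+) ray_parity z' a l = above a z z' (+) above (last a l) z z'.
Proof.
elim: l a => [|b l IH] a H /=; first by rewrite !addbb.
rewrite -(addbA (below z a b)) (addbCA (ray_parity z b l)).
rewrite addbA (@seg_parity _ a b z z'); last by apply: H; rewrite inE eqxx.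
rewrite IH; last by move=> u v h; apply: H; rewrite inE h orbT.
by rewrite -addbA addKb.
Qed.

Definition in_box o (rho : R) u :=
  (`|u.1 - o.1| < rho) && (`|u.2 - o.2| < rho).

Definition off_box o (rho : R) a b := forall s, 0 <= s <= 1 -> ~~ in_box o rho (seg_pt a b s).

Lemma norm_conv_lt (x y o rho s : R) : 0 <= s <= 1 ->
  `|x - o| < rho -> `|y - o| < rho -> `|x + s * (y - x) - o| < rho.
Proof.
move=> /andP[s0 s1] hx hy.
pose m := Num.max `|x - o| `|y - o|.
have -> : x + s * (y - x) - o = (1 - s) * (x - o) + s * (y - o) by ring.
have mr : m < rho by rewrite gt_max hx hy.
apply: le_lt_trans mr; apply: le_trans (ler_normD _ _) _.
have -> : m = (1 - s) * m + s * m by ring.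
rewrite !normrM (ger0_norm s0) ger0_norm ?subr_ge0 //.
by apply: lerD; apply: ler_wpM2l; rewrite ?subr_ge0 // le_max lexx ?orbT.
Qed.

Lemma seg_pt_in_box o rho a b s :
  in_box o rho a -> in_box o rho b -> 0 <= s <= 1 -> in_box o rho (seg_pt a b s).
Proof.
move=> /andP[a1 a2] /andP[b1 b2] hs.
by apply/andP; split; apply: norm_conv_lt.
Qed.

Lemma off_box_meets o rho a b z z' :
  off_box o rho a b -> in_box o rho z -> in_box o rho z' -> ~ meets a b z z'.
Proof.
move=> ob hz hz' [s [t [hs ht e]]].
by have := ob s hs; rewrite e (seg_pt_in_box hz hz' ht).
Qed.

End Polygons.

(** * Uniform bounds over finite types *)

Section FiniteBounds.
Local Open Scope ring_scope.
Variable R : realFieldType.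

Lemma finite_upper_bound (I : finType) (f : I -> R) :
  exists2 M, 0 < M & forall i, `|f i| < M.
Proof.
exists (1 + \sum_i `|f i|).
  by rewrite ltr_pwDl ?ltr01 // sumr_ge0.
move=> i; rewrite (bigD1 i) //= addrCA ltrDl ltr_pwDl ?ltr01 //.
by rewrite sumr_ge0.
Qed.

Lemma finite_lower_bound (I : finType) (P : pred I) (f : I -> R) :
  (forall i, P i -> 0 < f i) -> exists2 e, 0 < e & forall i, P i -> e < f i.
Proof.
move=> f0; have [M M0 HM] := finite_upper_bound (fun i => (f i)^-1).
exists M^-1; first by rewrite invr_gt0.
move=> i Pi; rewrite -[f i]invrK ltf_pV2 ?posrE ?invr_gt0 ?f0 //.
by apply: le_lt_trans (HM i); rewrite ler_norm.
Qed.

End FiniteBounds.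

(** * Corners of a polygonal drawing *)

Definition same_edge (T : eqType) (u v x y : T) : bool :=
  ((u == x) && (v == y)) || ((u == y) && (v == x)).

(* [K x y] stands for the corner at x that follows the edge x y in the rotation
   around x; its value is a Z/2-functional on edges, where only its restriction
   to the cycle space is meaningful, whence the coboundaries H. *)
Record corner_system (T : finType) (e : rel T) (K : T -> T -> T -> T -> bool) : Prop :=
  CornerSystem {
    corner_next : forall x y y0, e x y -> e x y0 -> y0 != y ->
      exists y' (H : T -> bool), [/\ e x y', y' != y & forall u v, e u v ->
        K x y u v (+) K x y' u v = H u (+) H v (+) same_edge u v x y'];
    corner_prev : forall x y, e x y ->
      exists y' (H : T -> bool), e x y' /\ forall u v, e u v ->
        K x y' u v (+) K x y u v = H u (+) H v (+) same_edge u v x y;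
    corner_opp : forall x y, e x y ->
      exists H : T -> bool, forall u v, e u v -> ~~ same_edge u v x y ->
        K x y u v (+) K y x u v = H u (+) H v }.

Lemma same_edge_addb (T : eqType) (u v x y : T) : u != v ->
  same_edge u v x y = ((u == x) && (v == y)) (+) ((v == x) && (u == y)).
Proof.
rewrite /same_edge [(v == x) && _]andbC; case: (eqVneq u x) => [->|_] //=.
case: (eqVneq v y) => [->|_] //= xy.
by rewrite (negPf xy).
Qed.

Lemma same_edgeC (T : eqType) (u v x y : T) : same_edge u v x y = same_edge x y u v.
Proof. by rewrite /same_edge !(eq_sym u) !(eq_sym v) [(y == u) && _]andbC. Qed.

Section Drawing.
Local Open Scope ring_scope.
Variables (R : realFieldType) (T : finType) (e : rel T).

(* The edge x y is drawn as the polygon p x, q x y, chain x y, p y, where the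
   last point of the chain is q y x; only the two extreme sides, called radii,
   are controlled near the ends of the edge.  The polygon may cross itself. *)
Record polygonal_drawing (p : T -> R * R) (q : T -> T -> R * R)
    (chain : T -> T -> seq (R * R)) : Prop := PolygonalDrawing {
  chain_last : forall x y, e x y -> last (q x y) (chain x y) = q y x;
  radius_neq0 : forall x y, e x y -> q x y <> p x;
  radius_indep : forall x y y' s t, e x y -> e x y' -> y != y' -> 0 <= s -> 0 <= t ->
    s * ((q x y).1 - (p x).1) = t * ((q x y').1 - (p x).1) ->
    s * ((q x y).2 - (p x).2) = t * ((q x y').2 - (p x).2) -> s = 0;
  radius_radius : forall x y x' y', e x y -> e x' y' -> x != x' ->
    ~ meets (p x) (q x y) (p x') (q x' y');
  radius_chain : forall x y x' y' u v, e x y -> e x' y' -> ~~ same_edge x y x' y' ->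
    (u, v) \in sides (q x' y') (chain x' y') -> ~ meets (p x) (q x y) u v;
  chain_chain : forall x y x' y' u v s t, e x y -> e x' y' -> ~~ same_edge x y x' y' ->
    (u, v) \in sides (q x y) (chain x y) ->
    (s, t) \in sides (q x' y') (chain x' y') -> ~ meets u v s t;
  vertex_box : exists2 rho, 0 < rho & forall x x' y', e x' y' ->
    (forall u v, (u, v) \in sides (q x' y') (chain x' y') -> off_box (p x) rho u v) /\
    (x != x' -> off_box (p x) rho (p x') (q x' y')) }.

(** * Turning a base point around a vertex of the drawing *)

Section Local.
Hypotheses (e_sym : symmetric e) (e_irr : irreflexive e).
Variables (p : T -> R * R) (q : T -> T -> R * R) (chain : T -> T -> seq (R * R)).
Hypothesis D : polygonal_drawing p q chain.
Hypothesis no_vertical : forall x y, e x y -> (q x y).1 != (p x).1.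

Definition parity (z : R * R) (u v : T) : bool :=
  below z (p u) (q u v) (+) ray_parity z (q u v) (chain u v) (+) below z (p v) (q v u).

(** Contributions at [q u v] and [q v u] cancel. What remains is the coboundary of w |->
    [above (p w) z z'], which is invisible on the cycle space. *)
Lemma parity_step z z' u v : e u v ->
    ~ meets (p u) (q u v) z z' -> ~ meets (p v) (q v u) z z' ->
    (forall a b, (a, b) \in sides (q u v) (chain u v) -> ~ meets a b z z') ->
  parity z u v (+) parity z' u v = above (p u) z z' (+) above (p v) z z'.
Proof.
move=> uv n1 n2 n3; rewrite /parity addbACA [X in X (+) _]addbACA.
rewrite !seg_parity // ray_parity_step // (chain_last D) //.
move: (above (p u) _ _) (above (q u v) _ _) (above (q v u) _ _) (above (p v) _ _).
by do 4!case.
Qed.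

Lemma parity_path z k u v : e u v ->
    (forall s t, (s, t) \in sides z k ->
      [/\ ~ meets (p u) (q u v) s t, ~ meets (p v) (q v u) s t &
       forall a b, (a, b) \in sides (q u v) (chain u v) -> ~ meets a b s t]) ->
  parity z u v (+) parity (last z k) u v = aboves (p u) z k (+) aboves (p v) z k.
Proof.
move=> uv; elim: k z => [|z' k IH] z H /=; first by rewrite !addbb.
rewrite -(addKb (parity z' u v) (parity (last z' k) u v)) addbA IH; last first.
  by move=> s t hst; apply: H; rewrite inE hst orbT.
have [|h1 h2 h3] := H z z'; first by rewrite inE eqxx.
by rewrite parity_step // addbACA.
Qed.

Definition slope x y := ((q x y).2 - (p x).2) / ((q x y).1 - (p x).1).
Definition right_of x y : bool := (p x).1 < (q x y).1.

(** Equal slopes on the same side would make the two radii positively proportional, against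
    [radius_indep]. *)
Lemma slope_inj x y y' : e x y -> e x y' ->
  right_of x y = right_of x y' -> slope x y = slope x y' -> y = y'.
Proof.
move=> xy xy'; have := no_vertical xy; have := no_vertical xy'.
rewrite -[in X in X -> _]subr_eq0 -[in X in _ -> X -> _]subr_eq0 /right_of /slope -!(subr_gt0 (p x).1).
have ind := @radius_indep _ _ _ D x y y' _ _ xy xy'.
move: ind; move: ((q x y).1 - _) ((q x y).2 - _) ((q x y').1 - _) ((q x y').2 - _).
move=> d1 d2 d1' d2' ind d1'0 d10 side sl; apply/eqP; apply/negPn/negP => yy.
have dd : `|d1'| * d1 = `|d1| * d1'.
  case: (ltP 0 d1) side => h /esym => [h'|/negbT]; first by rewrite !gtr0_norm // mulrC.
  by rewrite -leNgt => h'; rewrite !ler0_norm // !mulNr mulrC.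
have : `|d1'| = 0.
  apply: (ind _ `|d1|) => //.
  by rewrite -(divfK d10 d2) -(divfK d1'0 d2') sl mulrCA dd mulrCA.
by move/eqP; rewrite normr_eq0 (negPf d1'0).
Qed.

Variables (rho0 rho M : R).
Hypothesis rho0P : forall x x' y', e x' y' ->
    (forall u v, (u, v) \in sides (q x' y') (chain x' y') -> off_box (p x) rho0 u v) /\
    (x != x' -> off_box (p x) rho0 (p x') (q x' y')).
Hypothesis rho_gt0 : 0 < rho.
Hypothesis rhoP : forall x y, e x y -> rho < `|(q x y).1 - (p x).1|.
Hypothesis M_gt1 : 1 < M.
Hypothesis MP : forall x y, e x y -> `|slope x y| < M.
Hypothesis rhoM : rho * M < rho0.

(** These points lie on the vertical lines at distance [rho] from [p x]. By [rhoP] every radius at x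
    crosses the line on its side; by [rhoM] the points with |mu| <= M stay in the box that
    everything but the radii at x avoids. *)
Definition near_pt x (s : bool) (mu : R) : R * R :=
  if s then ((p x).1 + rho, (p x).2 + rho * mu)
  else ((p x).1 - rho, (p x).2 - rho * mu).

Lemma near_pt_box x s mu : `|mu| <= M -> in_box (p x) rho0 (near_pt x s mu).
Proof.
move=> hmu; have r1 : rho < rho0 by apply: le_lt_trans rhoM; rewrite ler_peMr // ltW.
have r2 : `|rho * mu| < rho0.
  by apply: le_lt_trans rhoM; rewrite normrM gtr0_norm // ler_pM2l.
have E (a b : R) : a + b - a = b by ring.
by case: s; rewrite /in_box /near_pt /= !E ?normrN r2 gtr0_norm ?r1.
Qed.

Lemma below_radius x s mu y : e x y ->
  below (near_pt x s mu) (p x) (q x y) =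
  (right_of x y == s) && (if s then mu < slope x y else slope x y < mu).
Proof.
move=> xy; have r0 := rho_gt0; have := rhoP xy; have := no_vertical xy.
rewrite /below /height /right_of /slope -subr_eq0.
set d1 := (q x y).1 - (p x).1; set d2 := (q x y).2 - (p x).2.
have -> : (q x y).1 = (p x).1 + d1 by rewrite /d1; ring.
clearbody d1 d2; move=> d10; rewrite ltrDl; case: (ltgtP 0 d1) => [h|h|h]; last by rewrite -h eqxx in d10.
- rewrite gtr0_norm // => hr; case: s => /=; last first.
    have -> : ((p x).1 <= (p x).1 - rho) = false by apply/negbTE; rewrite -ltNge; lra.
    have -> : ((p x).1 + d1 <= (p x).1 - rho) = false by apply/negbTE; rewrite -ltNge; lra.
    by [].
  have -> : (p x).1 <= (p x).1 + rho by lra.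
  have -> : ((p x).1 + d1 <= (p x).1 + rho) = false by apply/negbTE; rewrite -ltNge; lra.
  by rewrite /= ltrD2l [_ + rho]addrC addrK mulrCA ltr_pM2l.
rewrite ltr0_norm // => hr; case: s => /=.
  have -> : (p x).1 <= (p x).1 + rho by lra.
  by have -> : ((p x).1 + d1 <= (p x).1 + rho) by lra.
have -> : ((p x).1 <= (p x).1 - rho) = false by apply/negbTE; rewrite -ltNge; lra.
have -> : ((p x).1 + d1 <= (p x).1 - rho) by lra.
rewrite /= ltrD2l [_ - rho]addrC addrK mulrCA mulNr [- (rho * (d2 / d1))]lock.
by rewrite -lock ltrN2 ltr_pM2l.
Qed.

(** The failure of [seg_parity] for the radius x y, that is, whether the move z z' has to be counted
    as crossing it. *)
Definition defect x z z' y := below z (p x) (q x y) (+) below z' (p x) (q x y)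
  (+) (above (p x) z z' (+) above (q x y) z z').

(** Inside the box only radii at x can be met, so a correction arises only at an end of u v equal to
    x. *)
Lemma parity_box_step x z z' u v : e u v ->
    in_box (p x) rho0 z -> in_box (p x) rho0 z' ->
  parity z u v (+) parity z' u v = above (p u) z z' (+) above (p v) z z'
    (+) (((u == x) && defect x z z' v) (+) ((v == x) && defect x z z' u)).
Proof.
move=> uv bz bz'.
have rad w w' : e w w' -> below z (p w) (q w w') (+) below z' (p w) (q w w') =
    above (p w) z z' (+) above (q w w') z z' (+) ((w == x) && defect x z z' w').
  move=> ww'; case: (eqVneq w x) => [->|wx].
    by rewrite /= /defect [RHS]addbC addbK.
  rewrite addbF seg_parity //; apply: off_box_meets bz bz'.
  by have [_] := rho0P x ww'; apply; rewrite eq_sym.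
rewrite /parity addbACA [X in X (+) _]addbACA rad // ray_parity_step; last first.
  move=> a b ab; apply: off_box_meets bz bz'.
  by have [H _] := rho0P x uv; apply: H.
rewrite rad 1?e_sym // (chain_last D) //.
move: (above (p u) _ _) (above (q u v) _ _) (above (q v u) _ _) (above (p v) _ _).
by move: (_ && _) (_ && _); do 6!case.
Qed.

Lemma above_vertical u x s mu mu' : above u (near_pt x s mu) (near_pt x s mu') = false.
Proof. by rewrite /above /near_pt; case: s; rewrite /= eqxx. Qed.

Lemma defect_vertical x s mu mu' y : e x y ->
  defect x (near_pt x s mu) (near_pt x s mu') y = (right_of x y == s) &&
    (if s then (mu < slope x y) (+) (mu' < slope x y)
     else (slope x y < mu) (+) (slope x y < mu')).
Proof.
move=> xy; rewrite /defect !above_vertical !below_radius // !addbF.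
by case: (_ == _) => //; case: s.
Qed.

Lemma defect_vertical_between x s mu mu' y : e x y -> mu <= mu' ->
  slope x y != mu -> slope x y != mu' ->
  defect x (near_pt x s mu) (near_pt x s mu') y =
  (right_of x y == s) && (mu < slope x y < mu').
Proof.
move=> xy mm n1 n2; rewrite defect_vertical //; congr andb.
case: s; case: (ltgtP mu (slope x y)) n1 => // h1 _;
case: (ltgtP (slope x y) mu') n2 => // h2 _ //; lra.
Qed.

(** The move is the horizontal segment at height rho M over [p x]; a radius meeting it would have
    slope at least M in absolute value. *)
Lemma defect_top x y : e x y ->
  defect x (near_pt x true M) (near_pt x false (- M)) y = false.
Proof.
move=> xy; have r0 := rho_gt0; have M1 := M_gt1.
rewrite /defect seg_parity ?addbb //; move=> [s [t [hs ht]]].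
have := MP xy; have := no_vertical xy; rewrite -subr_eq0 /slope /seg_pt /near_pt /=.
move: ((q x y).1 - _) ((q x y).2 - _) => d1 d2 d10 hm [].
rewrite mulrN opprK.
set E1 := _ + _ * (_ - (_ + rho)); move=> h1 h2.
have {h1} h1 : s * d1 = rho * (1 - 2 * t).
  apply: (addrI (p x).1); rewrite h1 /E1; ring.
have {h2} h2 : s * d2 = rho * M.
  apply: (addrI (p x).2); rewrite h2; ring.
have : rho * M = rho * (1 - 2 * t) * (d2 / d1).
  by rewrite -h1 -h2; field.
rewrite -mulrA; move/(mulfI (lt0r_neq0 r0)) => hM.
have : `|M| < M.
  rewrite {1}hM normrM; apply: le_lt_trans hm.
  by rewrite ler_piMl // ler_norml; move/andP: ht => [t0 t1]; apply/andP; split; lra.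
by rewrite ltNge ler_norm.
Qed.

Definition dir_pt x (tau : R) : R * R :=
  if tau < M then near_pt x true tau else near_pt x false (tau - 2 * M).

Definition dir x y : R := if right_of x y then slope x y else slope x y + 2 * M.

(** Turning from tau to tau' changes the parity of exactly the radii at x swept on the way, up to a
    coboundary. *)
Lemma parity_dir x tau tau' : - M <= tau -> tau <= tau' -> tau' <= 3 * M ->
    (forall y, e x y -> dir x y != tau /\ dir x y != tau') ->
  exists H : T -> bool, forall u v, e u v ->
    parity (dir_pt x tau) u v (+) parity (dir_pt x tau') u v = H u (+) H v
    (+) (((u == x) && (tau < dir x v < tau')) (+) ((v == x) && (tau < dir x u < tau'))).
Proof.
have M1 := M_gt1; move=> t0 tt t1 nk.
have only (P Q : T -> bool) u v : e u v -> (forall y, e x y -> P y = Q y) ->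
    ((u == x) && P v) (+) ((v == x) && P u) = ((u == x) && Q v) (+) ((v == x) && Q u).
  move=> uv PQ; congr (_ (+) _).
    by case: (eqVneq u x) uv => [->|//] /PQ ->.
  by case: (eqVneq v x) uv => [->|//]; rewrite e_sym => /PQ ->.
have step s mu mu' u v : e u v -> `|mu| <= M -> `|mu'| <= M -> mu <= mu' ->
    (forall y, e x y -> right_of x y = s -> slope x y != mu /\ slope x y != mu') ->
    parity (near_pt x s mu) u v (+) parity (near_pt x s mu') u v =
    ((u == x) && ((right_of x v == s) && (mu < slope x v < mu')))
    (+) ((v == x) && ((right_of x u == s) && (mu < slope x u < mu'))).
  move=> uv m1 m2 mm n; rewrite (parity_box_step uv (near_pt_box _ _ m1) (near_pt_box _ _ m2)).
  rewrite !above_vertical.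
  have dy y : e x y -> defect x (near_pt x s mu) (near_pt x s mu') y =
      (right_of x y == s) && (mu < slope x y < mu').
    move=> xy; case: (eqVneq (right_of x y) s) => h.
      by have [n1 n2] := n _ xy h; rewrite defect_vertical_between // h eqxx.
    by rewrite defect_vertical // (negPf h).
  by apply: (only (defect x (near_pt x s mu) (near_pt x s mu'))
    (fun y => (right_of x y == s) && (mu < slope x y < mu')) u v uv).
have nM y : e x y -> `|slope x y| < M by exact: MP.
rewrite /dir_pt; have [tM|tM] := ltP tau M; have [tM'|tM'] := ltP tau' M.
- exists (fun=> false) => u v uv.
  rewrite step //; [|by rewrite ler_norml; lra|by rewrite ler_norml; lra|]; last first.
    by move=> y xy r; have := nk y xy; rewrite /dir r.
  apply: etrans (only (fun y => (right_of x y == true) && (tau < slope x y < tau'))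
    (fun y => tau < dir x y < tau') u v uv _) _ => // y xy; have := nM y xy; rewrite ltr_norml /dir => /andP[a b].
  case: (right_of x y) => //=; apply/esym/negbTE.
  by rewrite negb_and -!leNgt; apply/orP; right; lra.
(* Vertical moves have no [above] terms, so the coboundary comes only from the passage over the
   top. *)
- exists (fun u => above (p u) (near_pt x true M) (near_pt x false (- M))) => u v uv.
  have bM s : in_box (p x) rho0 (near_pt x s M) by apply: near_pt_box; rewrite gtr0_norm; lra.
  have bM' s : in_box (p x) rho0 (near_pt x s (-M)).
    by apply: near_pt_box; rewrite normrN gtr0_norm; lra.
  have s2 := parity_box_step uv (bM true) (bM' false).
  rewrite (only (defect x (near_pt x true M) (near_pt x false (- M))) (fun=> false) u v uv) in s2;
    last by move=> y; exact: defect_top.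
  rewrite /= !andbF !addbF in s2.
  have s1 : _ = _ := step true tau M u v uv _ _ (ltW tM) _.
  rewrite -(addKb (parity (near_pt x true M) u v) (parity (near_pt x false (tau' - 2 * M)) u v)).
  rewrite addbA s1; first 1 last.
  + by rewrite ler_norml; lra.
  + by rewrite gtr0_norm; lra.
  + move=> y xy r; have := nk y xy; rewrite /dir r => -[h _]; split=> //.
    by have := nM y xy; rewrite ltr_norml => /andP[_ /lt_eqF ->].
  have s3 : _ = _ := step false (- M) (tau' - 2 * M) u v uv _ _ _ _.
  rewrite -(addKb (parity (near_pt x false (- M)) u v) (parity (near_pt x false (tau' - 2 * M)) u v)).
  rewrite (addbA (parity (near_pt x true M) u v)) s2 s3; first 1 last.
  + by rewrite normrN gtr0_norm; lra.
  + by rewrite ler_norml; lra.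
  + lra.
  + move=> y xy r; have := nk y xy; rewrite /dir r => -[_ h]; split.
      by have := nM y xy; rewrite ltr_norml => /andP[/gt_eqF ->].
    by apply: contraNneq h => ->; apply/eqP; ring.
  rewrite [LHS]addbCA; congr (_ (+) _).
  rewrite addbACA -!andb_addr.
  apply: etrans (only (fun y => (right_of x y == true) && (tau < slope x y < M) (+) (right_of x y == false) && (- M < slope x y < tau' - 2 * M))
    (fun y => tau < dir x y < tau') u v uv _) _ => // y xy; have := nM y xy; rewrite ltr_norml /dir => /andP[a b].
  case: (right_of x y) => //=.
    rewrite b andbT addbF; case: (ltP tau (slope x y)) => //= _.
    by apply/esym; apply: lt_le_trans b tM'.
  rewrite a /= ltrBrDr.
  by have -> : tau < slope x y + 2 * M by lra.
- lra.
- exists (fun=> false) => u v uv.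
  rewrite step //; [|by rewrite ler_norml; lra|by rewrite ler_norml; lra|lra|]; last first.
    move=> y xy r; have := nk y xy; rewrite /dir r.
    by move=> [h h']; split; [apply: contraNneq h|apply: contraNneq h'] => ->; apply/eqP; ring.
  apply: etrans (only (fun y => (right_of x y == false) && (tau - 2 * M < slope x y < tau' - 2 * M))
    (fun y => tau < dir x y < tau') u v uv _) _ => // y xy; have := nM y xy; rewrite ltr_norml /dir => /andP[a b].
  case: (right_of x y) => //=.
    by apply/esym/negbTE; rewrite negb_and -!leNgt; apply/orP; left; lra.
  by rewrite ltrBrDr ltrBlDr.
Qed.

Variable eta : R.
Hypothesis eta_gt0 : 0 < eta.
Hypothesis eta_gap : forall x y y', e x y -> e x y' -> dir x y < dir x y' ->
  dir x y + eta < dir x y'.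
Hypothesis eta_max : forall x y, e x y ->
  `|slope x y + eta| < M.

Lemma dir_inj x y y' : e x y -> e x y' -> dir x y = dir x y' -> y = y'.
Proof.
move=> xy xy' h; have M1 := M_gt1; have := MP xy; have := MP xy'.
rewrite !ltr_norml => /andP[a1 a2] /andP[b1 b2].
apply: (slope_inj xy xy'); move: h; rewrite /dir.
- by case: (right_of x y); case: (right_of x y') => // h; exfalso; lra.
- by case: (right_of x y); case: (right_of x y') => // h; lra.
Qed.

(** The base point lies just past the radius x y counterclockwise; [eta_gap] places it before the
    next radius. *)
Definition corner x y := parity (dir_pt x (dir x y + eta)).

Lemma dir_eta_neq x y w : e x y -> e x w -> dir x w != dir x y + eta.
Proof.
move=> xy xw; have e0 := eta_gt0; case: (ltP (dir x y) (dir x w)) => h.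
  by have := eta_gap xy xw h; move/gt_eqF ->.
by rewrite lt_eqF //; lra.
Qed.

Lemma dir_eta_itv x y : e x y -> - M <= dir x y + eta <= 3 * M.
Proof.
move=> xy; have M1 := M_gt1; have := eta_max xy; rewrite ltr_norml /dir => /andP[a b].
by case: ifP => _; apply/andP; split; lra.
Qed.

(** Turning from just past x y1 to just past the next radius x y2 sweeps x y2 alone. *)
Lemma corner_step x y1 y2 : e x y1 -> e x y2 -> dir x y1 < dir x y2 ->
    (forall w, e x w -> dir x y1 < dir x w -> dir x y2 <= dir x w) ->
  exists H : T -> bool, forall u v, e u v ->
    corner x y1 u v (+) corner x y2 u v = H u (+) H v (+) same_edge u v x y2.
Proof.
move=> xy1 xy2 lt12 min2; have e0 := eta_gt0.
have /andP[a1 b1] := dir_eta_itv xy1; have /andP[a2 b2] := dir_eta_itv xy2.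
case: (@parity_dir x (dir x y1 + eta) (dir x y2 + eta)); [exact: a1|lra|exact: b2|
  by move=> w xw; split; apply: dir_eta_neq|move=> H HP].
have btw w : e x w -> (dir x y1 + eta < dir x w < dir x y2 + eta) = (w == y2).
  move=> xw; case: eqP => [->|/eqP wy].
    by rewrite (eta_gap xy1 xy2 lt12) /= ltrDl.
  apply/negbTE/negP => /andP[h1 h2].
  have h3 := min2 w xw (lt_trans (_ : dir x y1 < _ + eta) h1).
  have : dir x y2 < dir x w.
    rewrite lt_neqAle h3 ?ltrDl // andbT; apply: contra wy => /eqP /esym h.
    by apply/eqP; apply: (dir_inj xw xy2).
  by move/(eta_gap xy2 xw) => h; lra.
exists H => u v uv; rewrite /corner HP // same_edge_addb; last first.
  by apply: contraTneq uv => ->; rewrite e_irr.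
congr (_ (+) _ (+) (_ (+) _)).
  by case: (eqVneq u x) uv => [->|//] /btw ->.
by case: (eqVneq v x) uv => [->|//]; rewrite e_sym => /btw ->.
Qed.

(** Instead of passing under [p x], turn back from the last radius to the first: this sweeps all
    radii at x except x y2. All edges at x together form the coboundary of the indicator of x, and
    adding it leaves x y2 alone. *)
Lemma corner_wrap x y1 y2 : e x y1 -> e x y2 ->
    (forall w, e x w -> dir x w <= dir x y1) ->
    (forall w, e x w -> dir x y2 <= dir x w) ->
  exists H : T -> bool, forall u v, e u v ->
    corner x y1 u v (+) corner x y2 u v = H u (+) H v (+) same_edge u v x y2.
Proof.
move=> xy1 xy2 max1 min2; have e0 := eta_gt0.
have /andP[a1 b1] := dir_eta_itv xy1; have /andP[a2 b2] := dir_eta_itv xy2.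
case: (@parity_dir x (dir x y2 + eta) (dir x y1 + eta)); [exact: a2|
  by rewrite lerD2r; apply: max1|exact: b1|
  by move=> w xw; split; apply: dir_eta_neq|move=> H HP].
have btw w : e x w -> (dir x y2 + eta < dir x w < dir x y1 + eta) = (w != y2).
  move=> xw; case: eqP => [->|/eqP wy].
    by apply/negbTE/negP => /andP[h1 h2]; lra.
  have := max1 w xw; have := min2 w xw; rewrite le_eqVlt => /orP[/eqP h|h] hm.
    by rewrite (dir_inj xw xy2 (esym h)) eqxx in wy.
  by rewrite (eta_gap xy2 xw h) /=; lra.
exists (fun u => H u (+) (u == x)) => u v uv; rewrite /corner addbC HP // same_edge_addb; last first.
  by apply: contraTneq uv => ->; rewrite e_irr.
rewrite [X in _ = X (+) _]addbACA -[RHS]addbA; congr (_ (+) _).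
rewrite [RHS]addbACA; congr (_ (+) _).
  by case: (eqVneq u x) uv => [->|//] /btw ->; case: (v == y2).
by case: (eqVneq v x) uv => [->|//]; rewrite e_sym => /btw ->; case: (u == y2).
Qed.

Lemma dir_pt_eta x y : e x y ->
  dir_pt x (dir x y + eta) = near_pt x (right_of x y) (slope x y + eta).
Proof.
move=> xy; have := eta_max xy; rewrite ltr_norml /dir_pt /dir => /andP[a b].
case: (right_of x y); first by rewrite b.
have M1 := M_gt1; rewrite ifF; first by congr near_pt; ring.
by apply/negbTE; rewrite -leNgt; lra.
Qed.

Lemma near_pt_radius x y : e x y ->
  exists2 t, 0 < t <= 1 & near_pt x (right_of x y) (slope x y) = seg_pt (p x) (q x y) t.
Proof.
move=> xy; have r0 := rho_gt0; have := rhoP xy; have := no_vertical xy.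
rewrite -subr_eq0 /right_of -(subr_gt0 (p x).1) /near_pt /slope /seg_pt.
move: ((q x y).1 - _) ((q x y).2 - _) => d1 d2 d10 hr.
exists (rho / `|d1|).
  have n0 : 0 < `|d1| by rewrite normr_gt0.
  by rewrite divr_gt0 //= ler_pdivrMr // mul1r; apply: ltW.
case: (ltgtP 0 d1) d10 hr => [h d10 hr|h d10 hr|<- /eqP []] //.
  by rewrite gtr0_norm //; apply: injective_projections => /=; field; rewrite gt_eqF.
by rewrite ltr0_norm //; apply: injective_projections => /=; field; rewrite lt_eqF.
Qed.

Lemma meets_radius_end x y t u v : 0 < t <= 1 ->
  meets u v (seg_pt (p x) (q x y) t) (q x y) -> exists t' s,
  [/\ 0 < t' <= 1, 0 <= s <= 1 & seg_pt u v s = seg_pt (p x) (q x y) t'].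
Proof.
move=> /andP[t0 t1] [s [r [hs /andP[r0 r1] E]]].
exists ((1 - r) * t + r * 1), s; split => //.
  apply/andP; split; first by nra.
  by nra.
by rewrite E -seg_pt_comb seg_pt1.
Qed.

(** Another radius at x meets x y only in [p x], which 0 < t cuts off; the axioms of the drawing
    exclude the other pieces. *)
Lemma radius_end_clear x y u v t : e x y -> e u v -> ~~ same_edge u v x y -> 0 < t <= 1 ->
  [/\ ~ meets (p u) (q u v) (seg_pt (p x) (q x y) t) (q x y),
      ~ meets (p v) (q v u) (seg_pt (p x) (q x y) t) (q x y) &
      forall a b, (a, b) \in sides (q u v) (chain u v) ->
         ~ meets a b (seg_pt (p x) (q x y) t) (q x y)].
Proof.
move=> xy uv ns ht.
have rad u' v' : e u' v' -> ~~ ((u' == x) && (v' == y)) ->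
    ~ meets (p u') (q u' v') (seg_pt (p x) (q x y) t) (q x y).
  move=> uv' ns' /(meets_radius_end ht)[t' [s [/andP[t'0 t'1] hs E]]].
  case: (eqVneq u' x) ns' uv' E => [->|ux] /= vy uv' E.
    case: E => /addrI E1 /addrI E2.
    have := @radius_indep _ _ _ D x y v' t' s xy uv'.
    rewrite eq_sym => /(_ vy (ltW t'0)); case/andP: hs => s0 _ /(_ s0 (esym E1) (esym E2)) h.
    by rewrite h ltxx in t'0.
  by apply: (radius_radius D uv' xy ux); exists s, t'; rewrite (ltW t'0).
split.
- by apply: rad => //; apply: contra ns; rewrite /same_edge => ->.
- apply: rad; first by rewrite e_sym.
  by apply: contra ns; rewrite /same_edge andbC => ->; rewrite orbT.
move=> a b ab /(meets_radius_end ht)[t' [s [/andP[t'0 t'1] hs E]]].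
apply: (@radius_chain _ _ _ D x y u v a b) => //; first by rewrite same_edgeC.
by exists t', s; rewrite (ltW t'0).
Qed.

(** Sliding the base point back onto the radius x y crosses no other radius, so only the edge x y
    may notice. *)
Lemma eta_step x y u v : e x y -> e u v -> ~~ same_edge u v x y ->
  corner x y u v = parity (near_pt x (right_of x y) (slope x y)) u v.
Proof.
move=> xy uv ns; have e0 := eta_gt0.
have m1 := ltW (eta_max xy); have m2 := ltW (MP xy).
rewrite /corner dir_pt_eta //.
apply/eqP; rewrite -[_ == _]negb_add (parity_box_step uv (near_pt_box x _ m1) (near_pt_box x _ m2)).
rewrite !above_vertical /=.
have z w : e x w -> w != y ->
    defect x (near_pt x (right_of x y) (slope x y + eta)) (near_pt x (right_of x y) (slope x y)) w = false.
  move=> xw wy; rewrite defect_vertical //; case: eqP => //= side.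
  have := contra_neq (slope_inj xw xy side) wy.
  have gap := @eta_gap x y w xy xw; rewrite /dir side in gap.
  case: (ltgtP (slope x w) (slope x y)) => // h _.
    by case: (right_of x y); rewrite ?ltr_wpDr // ?ltW // ltNge ltW ?(lt_trans h) ?ltrDl.
  have {}gap : slope x y + eta < slope x w.
    by case: (right_of x y) gap => [/(_ h)//|]; rewrite ltrD2r => /(_ h); lra.
  by case: (right_of x y); rewrite ?gap // ltNge ltW.
have nuv : (u == x) && (v == y) = false.
  by apply: contraNF ns; rewrite /same_edge => ->.
have nvu : (v == x) && (u == y) = false.
  by apply: contraNF ns; rewrite /same_edge andbC => ->; rewrite orbT.
case: (eqVneq u x) uv nuv => [->|_] uv /= nuv.
  rewrite z ?nuv //; case: (eqVneq v x) uv => [->|//]; by rewrite e_irr.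
by case: (eqVneq v x) uv nvu => [->|//] uv /= nvu; rewrite z ?nvu // e_sym.
Qed.

(** The base point travels along the polygon of x y from one end to the other. No other edge meets
    this path, so their parities change only by the coboundary of [aboves]. *)
Lemma corner_opposite x y : e x y -> exists H : T -> bool, forall u v, e u v ->
  ~~ same_edge u v x y -> corner x y u v (+) corner y x u v = H u (+) H v.
Proof.
move=> xy; have yx : e y x by rewrite e_sym.
have [t ht Et] := near_pt_radius xy; have [t' ht' Et'] := near_pt_radius yx.
set z1 := near_pt x _ _ in Et; set z2 := near_pt y _ _ in Et'.
exists (fun w => aboves (p w) z1 (q x y :: rcons (chain x y) z2)) => u v uv ns.
have ns' : ~~ same_edge u v y x by apply: contra ns; rewrite /same_edge orbC.
rewrite (eta_step xy uv ns) (eta_step yx uv ns') -/z1 -/z2.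
rewrite -(parity_path uv) /= ?last_rcons // => a b.
rewrite /sides /= inE => /orP[/eqP[-> ->]|].
  by rewrite Et; apply: radius_end_clear.
have -> : zip (q x y :: rcons (chain x y) z2) (rcons (chain x y) z2)
        = rcons (sides (q x y) (chain x y)) (last (q x y) (chain x y), z2).
  elim: (chain x y) (q x y) => [|b0 l IH] a0 //=.
  by rewrite -IH.
rewrite (chain_last D xy) mem_rcons inE => /orP[/eqP[-> ->]|ab].
  rewrite Et'; have [h1 h2 h3] := radius_end_clear yx uv ns' ht'.
  by split=> [/meets_revr//|/meets_revr//|c d cd /meets_revr]; apply: h3.
split.
- by apply: (radius_chain D uv xy).
- apply: (@radius_chain _ _ _ D v u x y) => //; first by rewrite e_sym.
  by apply: contra ns; rewrite /same_edge andbC [(v == y) && _]andbC orbC.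
- by move=> c d cd; apply: (chain_chain D uv xy).
Qed.

Lemma corner_systemP : corner_system e corner.
Proof.
split=> [x y y0 xy xy0 y0y|x y xy|x y xy]; last exact: corner_opposite.
- case: (pickP (fun w => e x w && (dir x y < dir x w))) => [w0 hw0|none].
    have [y' /andP[xy' lt] min] :=
      @arg_minP _ _ T w0 (fun w => e x w && (dir x y < dir x w)) (dir x) hw0.
    have [|H HP] := corner_step xy xy' lt.
      by move=> w xw h; apply: min; rewrite xw.
    exists y', H; split => //; by apply: contraTneq lt => ->; rewrite ltxx.
  (* The radius x y is the last one, so the first one follows it; [y0] shows that they differ. *)
  have [y' xy' min] := @arg_minP _ _ T y (e x) (dir x) xy.
  have mx w : e x w -> dir x w <= dir x y.
    by move=> xw; have := none w; rewrite xw /= leNgt => ->.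
  have [H HP] := corner_wrap xy xy' mx min.
  exists y', H; split => //; apply: contra_neq y0y => E.
  by apply: (dir_inj xy0 xy); apply/eqP; rewrite eq_le mx // -E min.
- case: (pickP (fun w => e x w && (dir x w < dir x y))) => [w0 hw0|none].
    have [y' /andP[xy' lt] mx] :=
      @arg_maxP _ _ T w0 (fun w => e x w && (dir x w < dir x y)) (dir x) hw0.
    have [|H HP] := corner_step xy' xy lt; last by exists y', H.
    move=> w xw h; rewrite leNgt; apply/negP => h'.
    by have := mx w; rewrite xw h' => /(_ isT) /=; rewrite leNgt h.
  have [y' xy' mx] := @arg_maxP _ _ T y (e x) (dir x) xy.
  have [|H HP] := corner_wrap xy' xy mx; last by exists y', H.
  by move=> w xw; have := none w; rewrite xw /= leNgt => ->.
Qed.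

End Local.
End Drawing.

(** * Choice of the constants, and removal of vertical radii by a shear *)

Section CornersOfDrawing.
Local Open Scope ring_scope.
Variables (R : realFieldType) (T : finType) (e : rel T).
Hypotheses (e_sym : symmetric e) (e_irr : irreflexive e).

Lemma corner_system_no_vertical p q chain :
    polygonal_drawing e p q chain ->
    (forall x y : T, e x y -> (q x y).1 != (p x).1 :> R) ->
  exists K, corner_system e K.
Proof.
move=> D nv.
have [M0 M00 HM0] := finite_upper_bound (fun a : T * T => slope p q a.1 a.2).
(* The slack leaves room for [eta <= 1] in the bound on slope plus eta, and gives 1 < M. *)
pose M := M0 + 2.
have [rho0 rho00 box] := vertex_box D.
have d10 (a : T * T) : e a.1 a.2 -> 0 < `|(q a.1 a.2).1 - (p a.1).1|.
  by move=> /nv; rewrite normr_gt0 subr_eq0.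
have [r1 r10 Hr1] := finite_lower_bound d10.
pose rho := Num.min r1 (rho0 / (M + 1)).
have M1 : 1 < M by rewrite /M; lra.
have rho_gt0 : 0 < rho by rewrite lt_min r10 divr_gt0 //; lra.
have rhoM : rho * M < rho0.
  have : rho <= rho0 / (M + 1) by rewrite ge_min lexx orbT.
  rewrite ler_pdivlMr; last by lra.
  by nra.
have gap0 (a : T * T * T) : dir p q M a.1.1 a.1.2 < dir p q M a.1.1 a.2 ->
    0 < dir p q M a.1.1 a.2 - dir p q M a.1.1 a.1.2 by rewrite subr_gt0.
have [eta0 eta00 Heta] := finite_lower_bound gap0.
pose eta := Num.min eta0 1.
have eta_gt0 : 0 < eta by rewrite lt_min eta00 ltr01.
exists (corner p q chain rho M eta).
apply: (@corner_systemP R T e e_sym e_irr p q chain D nv rho0) => //.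
- move=> x y xy; apply: le_lt_trans (Hr1 (x, y) xy).
  by rewrite ge_min lexx.
- move=> x y xy; apply: lt_trans (HM0 (x, y)) _; rewrite /M; lra.
- move=> x y y' xy xy' lt; rewrite addrC -ltrBrDr.
  by apply: le_lt_trans (Heta (x, y, y') lt); rewrite ge_min lexx.
- move=> x y xy; apply: le_lt_trans (ler_normD _ _) _.
  have := HM0 (x, y); rewrite /= (gtr0_norm eta_gt0).
  have : eta <= 1 by rewrite ge_min lexx orbT.
  by rewrite /M => h1 h2; lra.
Qed.

Definition shear (k : R) (u : R * R) : R * R := (u.1 + k * u.2, u.2).

Lemma shear_seg_pt k a b s : shear k (seg_pt a b s) = seg_pt (shear k a) (shear k b) s.
Proof. by rewrite /shear /seg_pt /=; congr pair; ring. Qed.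

Lemma shear_inj k : injective (shear k).
Proof. by move=> [a b] [a' b'] [] /[swap] -> /addIr ->. Qed.

Lemma meets_shear k a b z z' :
  meets (shear k a) (shear k b) (shear k z) (shear k z') -> meets a b z z'.
Proof.
move=> [s [t [hs ht]]]; rewrite -!shear_seg_pt => /shear_inj E.
by exists s, t.
Qed.

Lemma sides_map (f : R * R -> R * R) a l :
  sides (f a) (map f l) = [seq (f b.1, f b.2) | b <- sides a l].
Proof. by elim: l a => [|b l IH] a //=; rewrite /sides /= -IH. Qed.

(** Undoing the shear adds at most k times the vertical distance to the horizontal one, hence the
    factor 1 + k. *)
Lemma in_box_shear k o rho u : 0 <= k ->
  in_box (shear k o) (rho / (1 + k)) (shear k u) -> in_box o rho u.
Proof.
move=> k0; rewrite /in_box /shear /= !ltr_pdivlMr; try by rewrite ltr_pwDl.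
move=> /andP[h1 h2]; have k1 : 0 < 1 + k by rewrite ltr_pwDl.
have h2' : `|u.2 - o.2| < rho.
  apply: le_lt_trans h2; rewrite ler_peMr //; lra.
rewrite h2' andbT.
have -> : u.1 - o.1 = (u.1 + k * u.2 - (o.1 + k * o.2)) + - (k * (u.2 - o.2)) by ring.
apply: le_lt_trans (ler_normD _ _) _.
rewrite normrN normrM (ger0_norm k0).
move: h1 h2; set A := `|_|; set B := `|_| => h1 h2.
have A0 : 0 <= A by rewrite normr_ge0.
have B0 : 0 <= B by rewrite normr_ge0.
clearbody A B.
have e1 : A + k * B = ((A * (1 + k)) + k * (B * (1 + k))) / (1 + k) by field; lra.
have h3 : k * (B * (1 + k)) <= k * rho by apply: ler_wpM2l => //; apply: ltW.
rewrite e1 ltr_pdivrMr //; lra.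
Qed.

Lemma off_box_shear k o rho a b : 0 <= k ->
  off_box o rho a b -> off_box (shear k o) (rho / (1 + k)) (shear k a) (shear k b).
Proof.
move=> k0 ob s hs; rewrite -shear_seg_pt; apply: contra (ob s hs).
exact: in_box_shear.
Qed.

Lemma polygonal_drawing_shear k p q chain : 0 <= k ->
    polygonal_drawing e p q chain ->
  polygonal_drawing e (fun x => shear k (p x)) (fun x y => shear k (q x y))
    (fun x y => map (shear k) (chain x y)).
Proof.
move=> k0 D; split.
- by move=> x y xy; rewrite last_map (chain_last D).
- by move=> x y xy /shear_inj /(radius_neq0 D xy).
- move=> x y y' s t xy xy' yy' s0 t0 /= h1 h2.
  apply: (@radius_indep _ _ _ _ _ _ D x y y' s t) => //.
  apply: (addIr (k * (s * ((q x y).2 - (p x).2)))).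
  rewrite [in RHS]h2; move: h1; rewrite ![_ + k * _ - _]addrAC => h1.
  have -> : s * ((q x y).1 - (p x).1) + k * (s * ((q x y).2 - (p x).2))
     = s * ((q x y).1 + k * (q x y).2 - ((p x).1 + k * (p x).2)) by ring.
  have -> : t * ((q x y').1 - (p x).1) + k * (t * ((q x y').2 - (p x).2))
     = t * ((q x y').1 + k * (q x y').2 - ((p x).1 + k * (p x).2)) by ring.
  by move: h1; rewrite ![_ - _ + _]addrAC.
- by move=> x y x' y' xy xy' xx /meets_shear; apply: (radius_radius D).
- move=> x y x' y' u v xy xy' ns; rewrite sides_map => /mapP[[a b] ab [-> ->]] /meets_shear.
  exact: (radius_chain D xy xy' ns ab).
- move=> x y x' y' u v s t xy xy' ns; rewrite !sides_map => /mapP[[a b] ab [-> ->]].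
  move=> /mapP[[c d] cd [-> ->]] /meets_shear.
  exact: (chain_chain D xy xy' ns ab cd).
- have [rho rho0 box] := vertex_box D; exists (rho / (1 + k)).
    by rewrite divr_gt0 // ltr_pwDl.
  move=> x x' y' xy'; have [h1 h2] := box x x' y' xy'; split.
    move=> u v; rewrite sides_map => /mapP[[a b] ab [-> ->]].
    by apply: off_box_shear => //; apply: h1.
  by move=> xx; apply: off_box_shear => //; apply: h2.
Qed.

(** Shear by some k above every |dx / dy| of a radius. A vertical image would mean dx + k dy = 0, so
    |dx / dy| = k, or dx = dy = 0. *)
Lemma corner_system_drawing p q chain :
  polygonal_drawing (R:=R) e p q chain -> exists K, corner_system e K.
Proof.
move=> D.
have [k k0 Hk] := finite_upper_bound
  (fun a : T * T => ((q a.1 a.2).1 - (p a.1).1) / ((q a.1 a.2).2 - (p a.1).2)).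
apply: (corner_system_no_vertical (polygonal_drawing_shear (ltW k0) D)).
move=> x y xy /=; have := Hk (x, y); have := radius_neq0 D xy.
rewrite /= -[_ == _]subr_eq0.
have -> : (q x y).1 + k * (q x y).2 - ((p x).1 + k * (p x).2) =
  ((q x y).1 - (p x).1) + k * ((q x y).2 - (p x).2) by ring.
case: (q x y) (p x) => [q1 q2] [p1 p2] /= neq hk; rewrite addr_eq0; apply/eqP => h.
move: hk; rewrite h; case: (eqVneq (q2 - p2) 0) => [E|n0].
  move/eqP: E h; rewrite subr_eq0 => /eqP E; rewrite E subrr mulr0 oppr0 => /eqP.
  by rewrite subr_eq0 => /eqP E'; case: neq; rewrite E E'.
by rewrite mulNr mulfK // normrN gtr0_norm // ltxx.
Qed.

End CornersOfDrawing.

(** * Euler-type counting *)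

Section Counting.
Local Open Scope ring_scope.
Variables (T : finType) (e : rel T).
Hypotheses (e_sym : symmetric e) (e_irr : irreflexive e).

(** Extend a path at its first vertex x, never towards the second vertex. Either the path grows,
    which stops at #|T| vertices, or the new neighbour lies on it and closes a cycle of length at
    least 3. *)
Lemma min_degree_cycle (S : {set T}) x0 : x0 \in S ->
    (forall x z, x \in S -> exists y, [/\ y \in S, e x y & y != z]) ->
  exists c, [/\ ucycle e c, (2 < size c)%N & {subset c <= S}].
Proof.
move=> x0S deg2.
suff ext n : (exists c, [/\ ucycle e c, (2 < size c)%N & {subset c <= S}]) \/
    exists x p, [/\ path e x p, uniq (x :: p), {subset x :: p <= S} & size p = n].
  have [//|[x [p [_ up _ sp]]]] := ext #|T|.
  by have := max_card (mem (x :: p)); rewrite (card_uniqP up) /= sp ltnn.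
elim: n => [|n [IH|[x [p [xp up sub sp]]]]].
- by right; exists x0, nil; split=> // y; rewrite inE => /eqP ->.
- by left.
have [|y [yS xy yz]] := deg2 x (head x p); first by apply: sub; rewrite inE eqxx.
have [yp|ynp] := boolP (y \in x :: p); last first.
  right; exists y, (x :: p); split => //=; rewrite ?ynp ?sp //.
    by rewrite e_sym xy.
  by move=> z; rewrite inE => /orP[/eqP ->|/sub].
left; move: yp; rewrite inE; case: eqP => [yx|_ /= yp]; first by rewrite yx e_irr in xy.
case/splitPr: p / yp xp up sub sp yz => p1 p2 xp up sub sp yz.
exists (x :: rcons p1 y); split.
- rewrite /ucycle /= rcons_path last_rcons e_sym xy andbT.
  move: xp; rewrite -cat_rcons cat_path => /andP[-> _] /=.
  by move: up; rewrite -cat_rcons -cat_cons cat_uniq => /andP[].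
- by rewrite /= size_rcons; case: (p1) yz => //=; rewrite eqxx.
- by move=> z zc; apply: sub; rewrite -cat_rcons -cat_cons mem_cat zc.
Qed.

Variable K : T -> T -> T -> T -> bool.
Hypothesis KP : corner_system e K.

Definition deg x := #|[set y | e x y]|.

Hypothesis deg_ge2 : forall x y, e x y -> (1 < deg x)%N.

Lemma other_neighbour x y : e x y -> exists2 y', e x y' & y' != y.
Proof.
move=> xy; have := deg_ge2 xy; rewrite /deg (cardsD1 y) inE xy /= add1n ltnS.
by move=> /card_gt0P[y']; rewrite !inE => /andP[n xy']; exists y'.
Qed.

(** Each edge occurs once, oriented by [enum_rank]; isolated vertices are left out of V. *)
Let E := [set a : T * T | e a.1 a.2 && (enum_rank a.1 < enum_rank a.2)%N].
Let V := [set x | [exists y, e x y]].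
Let m := #|E|.
Let edge (j : 'I_m) : T * T := enum_val j.

Definition f2 (b : bool) : 'F_2 := b%:R.

Lemma f2D a b : f2 (a (+) b) = f2 a + f2 b.
Proof. by case: a; case: b; apply/eqP. Qed.

Lemma f2_opp (x : 'F_2) : x + x = 0.
Proof. by rewrite -mulr2n -mulr_natr (_ : 2%:R = 0) ?mulr0 //; apply/eqP. Qed.

Let row (f : T -> T -> bool) : 'rV['F_2]_m := \row_j f2 (f (edge j).1 (edge j).2).

(** The incidence matrix mod 2, whose row space is the space of coboundaries. *)
Let B : 'M['F_2]_(#|V|, m) := \matrix_(i, j)
  f2 ((enum_val i == (edge j).1) (+) (enum_val i == (edge j).2)).

Lemma edgeP j : e (edge j).1 (edge j).2.
Proof. by have := enum_valP j; rewrite inE => /andP[]. Qed.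

Lemma edge_ends j : (edge j).1 \in V /\ (edge j).2 \in V.
Proof.
have := edgeP j => h; split; rewrite inE; apply/existsP.
  by exists (edge j).2.
by exists (edge j).1; rewrite e_sym.
Qed.

Lemma row_coboundary (H : T -> bool) :
  row (fun u v => H u (+) H v) = (\row_i f2 (H (enum_val i))) *m B.
Proof.
apply/rowP => j; rewrite !mxE f2D.
have one u : u \in V -> f2 (H u) = \sum_(i < #|V|) f2 (H (enum_val i)) * f2 (enum_val i == u).
  move=> uV; pose i0 := enum_rank_in uV u.
  have i0E : enum_val i0 = u by rewrite enum_rankK_in.
  rewrite (bigD1 i0) //= i0E eqxx mulr1 big1 ?addr0 // => i ne.
  case: eqP => [E1|]; last by rewrite mulr0.
  by case/eqP: ne; apply: enum_val_inj; rewrite E1.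
have [h1 h2] := edge_ends j.
rewrite (one _ h1) (one _ h2) -big_split; apply: eq_bigr => i _.
by rewrite !mxE f2D mulrDr.
Qed.

Lemma row_addb f g : row (fun u v => f u v (+) g u v) = row f + row g.
Proof. by apply/rowP => j; rewrite !mxE f2D. Qed.

Lemma eq_row f g : (forall u v, e u v -> (enum_rank u < enum_rank v)%N -> f u v = g u v) -> row f = row g.
Proof.
move=> fg; apply/rowP => j; rewrite !mxE fg //; first exact: edgeP.
by have := enum_valP j; rewrite inE => /andP[].
Qed.

(** Right multiplication by C has the coboundaries as kernel: it amounts to restricting functionals
    to the cycle space. *)
Let C := cokermx B.

Definition val x y : 'rV['F_2]_m := row (K x y) *m C.
Definition delta x y : 'rV['F_2]_m := row (fun u v => same_edge u v x y) *m C.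

Lemma deltaC x y : delta x y = delta y x.
Proof. by congr mulmx; apply: eq_row => u v _ _; rewrite /same_edge orbC. Qed.

Lemma add_row_self (w : 'rV['F_2]_m) : w + w = 0.
Proof. by apply/rowP => j; rewrite !mxE f2_opp. Qed.

Lemma add_rowK (a b c : 'rV['F_2]_m) : a + b = c -> a = c + b.
Proof. by move=> <-; rewrite -addrA add_row_self addr0. Qed.

Lemma val_relation x y x' y' (H : T -> bool) (b : bool) x1 y1 :
    (forall u v, e u v -> (enum_rank u < enum_rank v)%N ->
      K x y u v (+) K x' y' u v = H u (+) H v (+) (b && same_edge u v x1 y1)) ->
  val x y + val x' y' = if b then delta x1 y1 else 0.
Proof.
move=> h; rewrite /val -mulmxDl -row_addb.
rewrite (eq_row h) row_addb row_coboundary mulmxDl -mulmxA mulmx_coker mulmx0 add0r.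
case: b {h} => //=.
rewrite (_ : row _ = 0) ?mul0mx //; by apply/rowP => j; rewrite !mxE.
Qed.

Lemma val_next x y : e x y ->
  exists y', [/\ e x y', y' != y & val x y + val x y' = delta x y'].
Proof.
move=> xy; have [y0 xy0 ne] := other_neighbour xy.
have [y' [H [xy' ne' h]]] := corner_next KP xy xy0 ne.
by exists y'; split=> //; apply: (@val_relation _ _ _ _ H true) => u v uv _; apply: h.
Qed.

Lemma val_prev x y : e x y -> exists2 y', e x y' & val x y' + val x y = delta x y.
Proof.
move=> xy; have [y' [H [xy' h]]] := corner_prev KP xy.
by exists y' => //; apply: (@val_relation _ _ _ _ H true) => u v uv _; apply: h.
Qed.

(** [corner_opp] says nothing about the coordinate x y itself; this one unknown bit b decides
    between 0 and [delta x y]. *)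
Lemma val_opp x y : e x y -> val x y + val y x = 0 \/ val x y + val y x = delta x y.
Proof.
wlog: x y / (enum_rank x < enum_rank y)%N.
  move=> W xy; case: (ltngtP (enum_rank x) (enum_rank y)) => h.
  - exact: W.
  - by rewrite addrC deltaC; apply: W => //; rewrite e_sym.
  - by rewrite (enum_rank_inj (ord_inj h)) e_irr in xy.
move=> lt xy; have [H h] := corner_opp KP xy.
pose b := K x y x y (+) K y x x y (+) (H x (+) H y).
suff -> : val x y + val y x = if b then delta x y else 0 by case: b; [right|left].
apply: (val_relation (H := H)) => u v uv lt'.
case: (boolP (same_edge u v x y)) => [s|ns]; last by rewrite andbF addbF h.
rewrite andbT; case/orP: s => /andP[/eqP uE /eqP vE]; subst u v; last first.
  by rewrite ltnNge ltnW in lt'.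
by rewrite /b [RHS]addbC addbK.
Qed.

Let darts := [set a : T * T | e a.1 a.2].
Let Omega := [set val a.1 a.2 | a in darts].

(** The rows of C are the [delta] of the edges, each a sum of two corner values, so [Omega] spans a
    space of rank at least m - rank B. The rank of B is below #|V| because every edge has two ends,
    so that the rows of B sum to 0. *)
Lemma rank_bound : (m < #|Omega| + #|V|)%N \/ m = 0%N.
Proof.
have [m0|m0] := posnP m; [by right|left].
have Brank : (\rank B < #|V|)%N.
  rewrite ltn_neqAle rank_leq_row andbT; apply/negP => fr.
  have [V0|[x xV]] := set_0Vmem V.
    by have [] := edge_ends (Ordinal m0); rewrite V0 inE.
  have : \row_(i < #|V|) (1 : 'F_2) *m B = 0.
    transitivity (row (fun u v => true (+) true)); last first.
      by apply/rowP => j; rewrite !mxE.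
    by rewrite (row_coboundary (fun=> true)); congr mulmx; apply/rowP => i; rewrite !mxE.
  move/eqP; rewrite mulmx_free_eq0 // => /eqP/rowP/(_ (enum_rank_in xV x)).
  by rewrite !mxE.
pose W : 'M['F_2]_(#|Omega|, m) := \matrix_i enum_val i.
have inW w : w \in Omega -> (w <= W)%MS.
  move=> wO; rewrite -(enum_rankK_in wO wO) -(rowK (fun i : 'I_#|Omega| => enum_val i)).
  exact: row_sub.
have CW : (C <= W)%MS.
  apply/row_subP => j.
  have ej := edgeP j; have [y' [xy' _ h]] := val_next ej.
  have [y'' xy'' h'] := val_prev ej.
  have -> : matrix.row j C = delta (edge j).1 (edge j).2.
    rewrite rowE /delta; congr mulmx; apply/rowP => k; rewrite !mxE eqxx /=.
    rewrite /f2; congr (_ %:R); rewrite /same_edge.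
    have := enum_valP k; have := enum_valP j; rewrite !inE -!/(edge _).
    move=> /andP[_ lj] /andP[_ lk].
    case: (eqVneq k j) => [->|kj]; first by rewrite !eqxx.
    have n : ((edge k).1 == (edge j).1) && ((edge k).2 == (edge j).2) = false.
      apply: contraNF kj => /andP[/eqP e1 /eqP e2]; apply/eqP/enum_val_inj.
      by rewrite [LHS]surjective_pairing [RHS]surjective_pairing -!/(edge _) e1 e2.
    rewrite n /=; case: eqP => [e1|//] /=; case: eqP => [e2|//].
    by rewrite -e1 -e2 ltnNge ltnW in lj.
  rewrite -h'; apply: addmx_sub; apply: inW; apply/imsetP.
    by exists ((edge j).1, y''); rewrite ?inE.
  by exists ((edge j).1, (edge j).2); rewrite ?inE.
have := mxrankS CW; rewrite mxrank_coker => h.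
have := rank_leq_row W; have := rank_leq_col B; lia.
Qed.

(** The corner x y lies between two edges at x. Along either of them, to y' say, the values on the
    two sides at x are w and w + [delta x y'], and by [val_opp] the same pair occurs at y'. Thus
    both neighbours see w, and one of them is not z. *)
Lemma value_class x y w : e x y -> val x y = w ->
  forall z, exists y', [/\ e x y', y' != z & exists2 y'', e y' y'' & val y' y'' = w].
Proof.
move=> xy vw.
have far y' : e x y' -> val x y' = w \/ val x y' = w + delta x y' ->
    exists2 y'', e y' y'' & val y' y'' = w.
  move=> xy' hv; have yx : e y' x by rewrite e_sym.
  have [y'' yy'' hp] := val_prev yx.
  have {hp} := add_rowK hp; rewrite deltaC => hp.
  case: (val_opp xy') => ho; case: hv => hv.
  - exists x => //; move: ho; rewrite hv addrC => /add_rowK ->; by rewrite add0r.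
  - exists y'' => //; rewrite hp; move: ho; rewrite hv addrC => /add_rowK ->.
    by rewrite add0r addrCA add_row_self addr0.
  - exists y'' => //; rewrite hp; move: ho; rewrite hv addrC => /add_rowK ->.
    by rewrite addrA add_row_self add0r.
  - exists x => //; move: ho; rewrite hv addrC => /add_rowK ->.
    by rewrite addrCA add_row_self addr0.
have [y' [xy' ne h]] := val_next xy.
move=> z; case: (eqVneq y z) => [yz|yz]; last first.
  by exists y; split=> //; apply: far => //; left.
exists y'; split=> //; first by rewrite -yz.
apply: far => //; right; move: h; rewrite vw addrC => /add_rowK ->.
by rewrite addrC.
Qed.

Lemma dart_card : #|darts| = (m + m)%N.
Proof.
pose E' := [set a : T * T | e a.1 a.2 && (enum_rank a.2 < enum_rank a.1)%N].
have -> : darts = E :|: E'.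
  apply/setP => -[x y]; rewrite !inE /= -andb_orr; case xy: (e x y) => //=.
  apply/esym; rewrite -neq_ltn; apply: contraTneq xy => h.
  by rewrite (enum_rank_inj (ord_inj h)) e_irr.
have -> : E' = [set (a.2, a.1) | a in E].
  apply/setP => -[x y]; rewrite inE /=; apply/idP/imsetP => [h|[[x' y']]].
    by exists (y, x); rewrite ?inE //= e_sym.
  by rewrite inE /= e_sym => h [-> ->].
rewrite cardsU card_imset; last by move=> [? ?] [? ?] [-> ->].
rewrite (_ : _ :&: _ = set0) ?cards0 ?subn0 //.
apply/setP => -[x y]; rewrite !inE; apply/negP => /andP[/andP[_ /= h]] /imsetP[[x' y']].
by rewrite inE /= => /andP[_ h'] [xx yy]; move: h; rewrite xx yy ltnNge ltnW.
Qed.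

Lemma card_darts_at (P : pred T) :
  #|[set a in darts | P a.1]| = (\sum_(x in V | P x) deg x)%N.
Proof.
rewrite -sum1_card (partition_big (fun a => a.1) [pred x | (x \in V) && P x]) /=; last first.
  move=> [x y]; rewrite !inE /= => /andP[xy ->]; rewrite andbT.
  by apply/existsP; exists y.
apply: eq_bigr => x /andP[_ Px]; rewrite sum1_card /deg.
rewrite -(@card_imset _ _ (pair x) (mem [set y | e x y])); last by move=> ? ? [].
apply: eq_card => -[x' y]; rewrite [LHS]unfold_in /= !inE /=; apply/idP/imsetP.
  move=> /andP[/andP[xy _] /eqP <-]; exists y => //; by rewrite inE.
by move=> [y']; rewrite inE => xy [-> ->]; rewrite xy Px eqxx.
Qed.

(** The vertices that see a value w contain a cycle, and each branch vertex on it owns a corner of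
    value w. So a value with at most five corners at branch vertices is enough. *)
Lemma cycle_with_few_branch_vertices x0 y0 : e x0 y0 ->
  exists c, [/\ ucycle e c, (2 < size c)%N & (count (fun x => 2 < deg x) c <= 5)%N].
Proof.
move=> xy0.
pose D3 := [set a in darts | (2 < deg a.1)%N].
suff : exists2 w, w \in Omega & (#|[set a in D3 | val a.1 a.2 == w]| <= 5)%N.
  move=> [w /imsetP[[x y]]]; rewrite inE /= => xy wE le5.
  pose S := [set x | [exists y, e x y && (val x y == w)]].
  have [||c [uc sc cS]] := @min_degree_cycle S x.
  - by rewrite inE; apply/existsP; exists y; rewrite xy wE eqxx.
  - move=> x' z; rewrite inE => /existsP[y' /andP[xy' /eqP vw]].
    have [y1 [h1 h2 [y2 h3 h4]]] := value_class xy' vw z.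
    by exists y1; split=> //; rewrite inE; apply/existsP; exists y2; rewrite h3 h4 eqxx.
  exists c; split=> //; apply: leq_trans le5.
  have uniqc : uniq c by case/andP: uc.
  rewrite -size_filter -(card_uniqP (filter_uniq _ uniqc)).
  apply: leq_trans (_ : #|[set a.1 | a in [set a in D3 | val a.1 a.2 == w]]| <= _)%N; last exact: leq_imset_card.
  apply/subset_leq_card/subsetP => z; rewrite mem_filter => /andP[dz /cS].
  rewrite inE => /existsP[z' /andP[zz vz]]; apply/imsetP; exists (z, z') => //.
  by rewrite !inE /= zz dz vz.
apply/exists_inP; apply: contraPT isT; rewrite negb_exists_in => /forall_inP H _.
have sumD : (6 * #|Omega| <= #|D3|)%N.
  rewrite -[X in (_ <= X)%N]sum1_card (partition_big (fun a => val a.1 a.2) (mem Omega)) /=; last first.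
    by move=> a; rewrite !inE => /andP[ha _]; apply: imset_f; rewrite inE.
  rewrite mulnC -sum_nat_const; apply: leq_sum => w wO.
  rewrite sum1_card; have := H w wO; rewrite -ltnNge => h; apply: leq_trans h _.
  by apply/eq_leq/eq_card => a; rewrite [RHS]unfold_in /= !inE.
have hD3 : #|D3| = (\sum_(x in V | (2 < deg x)%N) deg x)%N by exact: card_darts_at.
have hD : #|darts| = (\sum_(x in V | (2 < deg x)%N) deg x + \sum_(x in V | ~~ (2 < deg x)%N) deg x)%N.
  have -> : #|darts| = #|[set a in darts | xpredT a.1]|.
    by apply: eq_card => a; rewrite !inE andbT.
  rewrite (card_darts_at xpredT) (bigID (fun x => (2 < deg x)%N)) /=.
  by congr (_ + _)%N; apply: eq_bigl => x; rewrite andbT.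
have hV : #|V| = (\sum_(x in V | (2 < deg x)%N) 1 + \sum_(x in V | ~~ (2 < deg x)%N) 1)%N.
  by rewrite -sum1_card (bigID (fun x => (2 < deg x)%N)).
have h3 : (3 * \sum_(x in V | (2 < deg x)%N) 1 <= #|D3|)%N.
  by rewrite hD3 big_distrr /=; apply: leq_sum => x /andP[_ ?]; rewrite muln1.
have h2 : (\sum_(x in V | ~~ (2 < deg x)%N) deg x = 2 * \sum_(x in V | ~~ (2 < deg x)%N) 1)%N.
  rewrite big_distrr /=; apply: eq_bigr => x /andP[]; rewrite inE => /existsP[y /deg_ge2 d2].
  by rewrite -leqNgt muln1 => d2'; apply/eqP; rewrite eqn_leq d2 d2'.
have m0 : m <> 0%N.
  move=> m0; have := dart_card; rewrite m0 => /eqP; rewrite cards_eq0 => /eqP/setP/(_ (x0, y0)).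
  by rewrite !inE xy0.
(* With n2 vertices of degree 2 and n3 of larger degree, 6m < 6|Omega| + 6 n2 + 6 n3 <= 3|D3| + 6 n2
   = 3|darts| = 6m. *)
case: rank_bound => // hr; have := dart_card; lia.
Qed.

End Counting.

(** * Non-backtracking walks in the odd graph *)

Section OddGraphWalks.
Variables (K : finType) (N : nat).
Hypothesis cardK : #|K| = N.*2.+1.
Implicit Types (P Q A B C : {set K}) (s : seq (K * K)).

(* Two steps of the odd graph exchange one element of a set; a pair (y, x) is
   the exchange that removes y and adds x. A walk does not backtrack when it
   never removes the element it has just added. *)
Fixpoint exchanges (z : K) P s : bool :=
  if s is (y, x) :: s' then
    [&& y \in P, y != z, x \notin P & exchanges x (x |: P :\ y) s']
  else true.

Fixpoint exchanged P s : {set K} :=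
  if s is (y, x) :: s' then exchanged (x |: P :\ y) s' else P.

Definition last_added z s : K := last z (unzip2 s).

Lemma exchanges_cat z P s s' : exchanges z P (s ++ s') =
  exchanges z P s && exchanges (last_added z s) (exchanged P s) s'.
Proof. by elim: s z P => [|[y x] s IH] z P //=; rewrite IH -!andbA. Qed.

Lemma exchanged_cat P s s' : exchanged P (s ++ s') = exchanged (exchanged P s) s'.
Proof. by elim: s P => [|[y x] s IH] P //=. Qed.

(** Removed elements come from P and added ones from outside, so only the first removal has to be
    compared with the element added last, z. *)
Lemma exchanges_zip z P (l l' : seq K) :
    size l = size l' -> uniq l -> uniq l' -> {subset l <= P} ->
    {in l', forall x, x \notin P} -> (l != [::] -> head z l != z) ->
  exchanges z P (zip l l') /\
  exchanged P (zip l l') = (P :\: [set x in l]) :|: [set x in l'].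
Proof.
elim: l l' z P => [|a l IH] [|b l'] //= z P.
  move=> _ _ _ _ _ _; split=> //.
  by apply/setP => x; rewrite !inE orbF.
move=> [sz] /andP[al ul] /andP[bl ul'] sub out hz.
have aP : a \in P by apply: sub; rewrite inE eqxx.
have bP : b \notin P by apply: out; rewrite inE eqxx.
have [|||h1 h2] := IH l' b (b |: P :\ a) sz ul ul'.
- move=> x xl; rewrite !inE (sub x) ?inE ?xl ?orbT // andbT.
  by rewrite (memPn al) ?orbT.
- move=> x xl; rewrite !inE negb_or (memPn bl) //= negb_and (out x) ?orbT //.
  by rewrite inE xl orbT.
- case: (l) sub => //= x l0 sub _; apply: contraNneq bP => <-.
  by apply: sub; rewrite !inE eqxx orbT.
split; first by rewrite aP bP hz ?h1.
rewrite h2; apply/setP => x; rewrite !inE.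
case: (eqVneq x b) => [->|_] /=; last by case: (eqVneq x a); rewrite //= andbF.
have -> : b \notin l by apply: contra bP => bl0; apply: sub; rewrite inE bl0 orbT.
by rewrite orbT.
Qed.

(* Moving a hole: each step fills the current hole and opens the next one. *)
Lemma exchanges_chain z P c (l : seq K) a :
    c \notin P -> uniq (rcons l a) -> {subset rcons l a <= P} -> head a l != z ->
  exchanges z P (zip (rcons l a) (c :: l)) /\
  exchanged P (zip (rcons l a) (c :: l)) = c |: P :\ a.
Proof.
elim: l z P c => [|d l IH] z P c /= cP.
  by move=> _ sub az; rewrite sub ?inE // az cP.
move=> /andP[dl ul] sub dz.
have dP : d \in P by apply: sub; rewrite inE eqxx.
have [|||h1 h2] := IH c (c |: P :\ d) d _ ul.
- by rewrite !inE eqxx orbF; apply: contraNneq cP => <-.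
- move=> x xl; rewrite !inE (sub x) ?inE ?xl ?orbT // andbT.
  by rewrite (memPn dl) ?orbT.
- apply: contraNneq cP => <-; apply: sub; rewrite inE; apply/orP; right.
  by case: (l) => [|x l0]; rewrite !inE eqxx.
split; first by rewrite dP dz cP h1.
rewrite h2; apply/setP => x; rewrite !inE.
have ad : a != d by apply: (memPn dl); rewrite mem_rcons inE eqxx.
have ac : a != c by apply: contraNneq cP => <-; apply: sub; rewrite inE mem_rcons inE eqxx orbT.
case: (eqVneq x d) => [->|_] /=; first by rewrite dP andbT (eq_sym d a) ad orbT.
by case: (eqVneq x c) => [->|_] //=; rewrite (eq_sym c a) ac.
Qed.

Lemma set_list_head C z m : 0 < m <= #|C| -> 1 < #|C| ->
  exists l, [/\ uniq l, size l = m, {subset l <= C} & forall w, head w l != z].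
Proof.
move=> /andP[m0 mC] C1.
have [c] : exists c, c \in C :\ z.
  by apply/set0Pn; rewrite -card_gt0; have := cardsD1 z C; case: (z \in C); lia.
rewrite !inE => /andP[cz cC].
exists (c :: take m.-1 (enum (C :\ c))); split => //=.
- rewrite take_uniq ?enum_uniq // andbT; apply/negP => /mem_take.
  by rewrite mem_enum !inE eqxx.
- rewrite size_takel ?prednK // -cardE; have := cardsD1 c C; rewrite cC; lia.
- by move=> x; rewrite inE => /orP[/eqP ->//|/mem_take]; rewrite mem_enum !inE => /andP[].
Qed.

Lemma set_list_last C z m : 0 < m <= #|C| -> 1 < #|C| ->
  exists l, [/\ uniq l, size l = m, {subset l <= C} & forall w, last w l != z].
Proof.
move=> hm C1; have [l [ul sl lC hl]] := set_list_head z hm C1.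
exists (rev l); split; rewrite ?rev_uniq ?size_rev //.
  by move=> x; rewrite mem_rev; apply: lC.
move=> w; case: l hl sl hm {ul lC} => [|x l] hl sl; first by rewrite -sl.
by move=> _; rewrite rev_cons last_rcons; apply: (hl w).
Qed.

Lemma set_list_ends C z z' m : 1 < m < #|C| ->
  exists l, [/\ uniq l, size l = m, {subset l <= C}, forall w, head w l != z
    & forall w, last w l != z'].
Proof.
move=> /andP[m1 mC].
have [c] : exists c, c \in C :\ z.
  by apply/set0Pn; rewrite -card_gt0; have := cardsD1 z C; case: (z \in C); lia.
rewrite !inE => /andP[cz cC].
have [||l [ul sl lC hl]] := @set_list_last (C :\ c) z' m.-1.
- by have := cardsD1 c C; rewrite cC; lia.
- by have := cardsD1 c C; rewrite cC; lia.
exists (c :: l); split => //=.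
- by rewrite ul andbT; apply/negP => /lC; rewrite !inE eqxx.
- by rewrite sl prednK //; lia.
- by move=> x; rewrite inE => /orP[/eqP ->//|/lC]; rewrite !inE => /andP[].
Qed.

(** With k = |A \ B|, k exchanges would do. The N - k spare ones move a hole through N - k common
    elements, which replaces one exchange by N - k + 1. The conditions on z and z' are met by
    choosing the first element removed and the last one added; N >= 3 leaves room for both. *)
Lemma exchange_walk A B z z' : 3 <= N -> #|A| = N.+1 -> #|B| = N.+1 ->
  exists s, [/\ size s = N, exchanges z A s, exchanged A s = B & last_added z s != z'].
Proof.
move=> N3 cA cB.
pose X := A :\: B; pose Y := B :\: A; pose C := A :&: B.
have hX : #|C| + #|X| = N.+1 by rewrite -cA cardsID.
have hY : #|C| + #|Y| = N.+1 by rewrite /C setIC -cB cardsID.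
have C1 : 0 < #|C|.
  have := cardsUI A B; have := max_card (A :|: B); rewrite cardK cA cB -/C; lia.
(* Trades a for b by a detour through the common elements c :: l. With a = b this is a closed walk,
   and l nonempty keeps b from being removed right after it was added. *)
have chain_start b a c l : b \notin A -> uniq (c :: l) -> {subset c :: l <= C} ->
    c != z -> (a \in X \/ a = b /\ l != [::]) ->
    let s := (c, b) :: zip (rcons l a) (c :: l) in
    [/\ size s = (size l).+2, exchanges z A s, exchanged A s = (b |: A) :\ a & last_added z s = last c l].
  move=> bA /= /andP[cl ul] lC cz ha.
  have cC : c \in C by apply: lC; rewrite inE eqxx.
  have cA' : c \in A by move: cC; rewrite inE => /andP[].
  have cb : c != b by apply: contraNneq bA => <-.
  have aC : a \notin c :: l.
    apply/negP => /lC; rewrite !inE; case: ha => [|[-> _]]; first by rewrite !inE => /andP[/negPf ->]; rewrite andbF.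
    by rewrite (negPf bA).
  move: aC; rewrite inE negb_or => /andP[ac al].
  have [|||| h1 h2] := @exchanges_chain b (b |: A :\ c) c l a.
  - by rewrite !inE eqxx orbF.
  - by rewrite rcons_uniq al ul.
  - move=> x; rewrite mem_rcons inE => /orP[/eqP ->|xl].
      case: ha => [|[-> _]]; last by rewrite !inE eqxx.
      by rewrite !inE ac => /andP[_ ->]; rewrite orbT.
    have : x \in C by apply: lC; rewrite inE xl orbT.
    rewrite !inE (memPn cl) // => /andP[-> _]; by rewrite orbT.
  - case: (l) lC ha => [|x l0] lC ha /=.
      case: ha => [|[]//]; rewrite inE => /andP[_ aA].
      by apply: contraNneq bA => <-.
    apply: contraNneq bA => <-.
    have : x \in C by apply: lC; rewrite !inE eqxx orbT.
    by rewrite inE => /andP[].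
  split.
  - by rewrite -[LHS]/((size (zip (rcons l a) (c :: l))).+1) size_zip size_rcons /= minnn.
  - by rewrite /= cA' cz bA h1.
  - rewrite h2; apply/setP => x; rewrite !inE.
    by case: (eqVneq x c) => [->|_] //=; rewrite cA' orbT (eq_sym c a) ac.
  - by rewrite -[LHS]/(last b (unzip2 (zip (rcons l a) (c :: l)))) unzip2_zip ?size_rcons.
(* Case k = 0: an outside element o enters first and leaves last, around N - 1 elements of A. *)
case: (posnP #|X|) => X0.
- have AB : A = B.
    by apply/eqP; rewrite eqEcard cA cB leqnn andbT; move/eqP: X0; rewrite cards_eq0 setD_eq0.
  have [o oA] : exists o, o \in ~: A.
    by apply/set0Pn; rewrite -card_gt0; have := cardsC A; rewrite cA cardK; lia.
  rewrite inE in oA.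
  have [|[|c l] [ul sl lC hl ll]] := @set_list_ends C z z' N.-1.
  - lia.
  - by move: sl => /= sl; lia.
  have [|h1 h2 h3 h4] := chain_start o o c l oA ul lC (hl c).
  - by right; split=> //; case: (l) sl => //= ?; lia.
  exists ((c, o) :: zip (rcons l o) (c :: l)); rewrite h1 h4; split => //.
  - by move: sl => /=; lia.
  - by rewrite h3 -AB setU1K.
  - exact: (ll c).
have full (S : {set K}) (l : seq K) : uniq l -> size l = #|S| -> {subset l <= S} ->
    forall x, (x \in l) = (x \in S).
  move=> ul sl lS x; have [||_ ->] := @uniq_min_size _ l (enum S) ul; rewrite ?mem_enum //.
    by move=> y /lS; rewrite mem_enum.
  by rewrite -cardE sl.
have swap (a b : K) as' bs' : (forall x, (x \in X) = (x == a) || (x \in as')) ->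
    (forall x, (x \in Y) = (x == b) || (x \in bs')) ->
    (((b |: A) :\ a) :\: [set x in as']) :|: [set x in bs'] = B.
  move=> eX eY; apply/setP => x; have := eX x; have := eY x; rewrite !inE.
  by case: (x \in A); case: (x \in B); case: (x == a); case: (x == b);
    case: (x \in as'); case: (x \in bs').
have [bl [ubl sbl blY lastb]] : exists l, [/\ uniq l, size l = #|Y|, {subset l <= Y} &
    1 < #|Y| -> forall w, last w l != z'].
  case: (ltnP 1 #|Y|) => Y1; last first.
    by exists (enum Y); split=> //; rewrite ?enum_uniq -?cardE // => x; rewrite mem_enum.
  have [|l [h1 h2 h3 h4]] := @set_list_last Y z' #|Y| _ Y1; last by exists l.
  by rewrite leqnn andbT ltnW.
have memY := full Y bl ubl sbl blY.
(* Case k = N: no spare exchange is left, and X is traded for Y directly. *)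
case: (eqVneq #|X| N) => [XN|XN].
- have [||al [ual sal alX hal]] := @set_list_head X z #|X|; [lia|lia|].
  have memX := full X al ual sal alX.
  have sz : size al = size bl by rewrite sal sbl; lia.
  have [|||h1 h2] := @exchanges_zip z A al bl sz ual ubl.
  + by move=> x /alX; rewrite inE => /andP[].
  + by move=> x /blY; rewrite inE => /andP[].
  + by move=> _; apply: hal.
  exists (zip al bl); split=> //.
  + by rewrite size_zip -sz minnn sal.
  + rewrite h2; apply/setP => x; rewrite !inE memX memY !inE.
    by case: (x \in A); case: (x \in B).
  + rewrite /last_added unzip2_zip ?sz //; apply: lastb; lia.
(* For k = 1 the walk ends inside the detour, so the last element of [cl] must differ from z'; for
   larger k this is the task of [bl]. *)
have [cl [ucl scl clC hcl lcl]] : exists l, [/\ uniq l, size l = N - #|X|, {subset l <= C},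
    forall w, head w l != z & #|X| = 1 -> forall w, last w l != z'].
  case: (eqVneq #|X| 1) => [X1|X1].
    have [|l [h1 h2 h3 h4 h5]] := @set_list_ends C z z' (N - #|X|); first by lia.
    by exists l; split.
  have [||l [h1 h2 h3 h4]] := @set_list_head C z (N - #|X|); [lia|lia|].
  by exists l; split=> // X1'; rewrite X1' in X1.
case: cl ucl scl clC hcl lcl => [|c l] ucl scl clC hcl lcl; first by move: scl => /=; lia.
case: bl ubl sbl blY lastb memY => [|b bs'] ubl sbl blY lastb memY; first by move: sbl => /=; lia.
have [al [ual sal alX]] : exists l, [/\ uniq l, size l = #|X| & {subset l <= X}].
  by exists (enum X); split; rewrite ?enum_uniq -?cardE // => x; rewrite mem_enum.
have memX := full X al ual sal alX.
case: al ual sal alX memX => [|a as'] ual sal alX memX; first by move: sal => /=; lia.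
have aX : a \in X by apply: alX; rewrite inE eqxx.
have bA : b \notin A by have := blY b; rewrite !inE eqxx => /(_ isT)/andP[].
have [|h1 h2 h3 h4] := chain_start b a c l bA ucl clC (hcl c); first by left.
have sz : size as' = size bs' by move: sal sbl => /=; lia.
move: ual ubl => /= /andP[aas uas] /andP[bbs ubs].
have [|||g1 g2] := @exchanges_zip (last c l) ((b |: A) :\ a) as' bs' sz uas ubs.
- move=> x xa; have := alX x; rewrite !inE xa orbT => /(_ isT)/andP[_ ->].
  by rewrite (memPn aas) // orbT.
- move=> x xb; have := blY x; rewrite !inE xb orbT => /(_ isT)/andP[/negPf -> _].
  by rewrite (negPf (memPn bbs x xb)) andbF.
- case: (as') alX => // d as0 alX _ /=.
  have dX : d \in X by apply: alX; rewrite !inE eqxx orbT.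
  have lC : last c l \in C by apply: clC; exact: mem_last.
  by apply: contraTneq dX => ->; move: lC; rewrite !inE => /andP[_ ->].
exists (((c, b) :: zip (rcons l a) (c :: l)) ++ zip as' bs'); split.
- by rewrite size_cat h1 size_zip sz minnn; move: scl sbl hX hY => /=; clear; lia.
- by rewrite exchanges_cat h2 h3 h4 g1.
- by rewrite exchanged_cat h3 g2 swap // => x; rewrite -?memX -?memY inE.
- rewrite /last_added /unzip2 map_cat last_cat -/(unzip2 _) -/(last_added z _) h4.
  rewrite -/(unzip2 (zip as' bs')) unzip2_zip ?sz //.
  case: (bs') sbl lastb sz => [|d bs0] sbl lastb sz /=.
    by apply: (lcl _ c); move: sal; rewrite /= sz => <-.
  by apply: (lastb _ c); rewrite -sbl.
Qed.

(** U and V are the last two vertices visited before l; U is kept to forbid backtracking. *)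
Fixpoint odd_walk (U V : {set K}) (l : seq {set K}) : bool :=
  if l is W :: l' then
    [&& #|W| == N, [disjoint V & W], W != U & odd_walk V W l']
  else true.

(** P is the complement of the current vertex: deleting y gives a neighbour in the odd graph, and
    adding x then gives the complement of the vertex after it. *)
Fixpoint walk_of P s : seq {set K} :=
  if s is (y, x) :: s' then (P :\ y) :: ~: (x |: P :\ y) :: walk_of (x |: P :\ y) s'
  else [::].

Lemma size_walk_of P s : size (walk_of P s) = (size s).*2.
Proof. by elim: s P => [|[y x] s IH] P //=; rewrite IH doubleS. Qed.

Lemma setD1_inj P x y : x \in P -> x != y -> P :\ x != P :\ y.
Proof. by move=> xP xy; apply/eqP => /setP/(_ x); rewrite !inE eqxx xy xP. Qed.

(** The previous vertex is [P :\ z], so y != z forbids returning to it; after the deletion of y, the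
    condition x \notin P forbids returning to [~: P]. *)
Lemma odd_walk_of z z' P s : #|P| = N.+1 -> z \in P ->
    exchanges z P s -> last_added z s != z' -> z' \in exchanged P s ->
  odd_walk (P :\ z) (~: P) (rcons (walk_of P s) (exchanged P s :\ z')).
Proof.
elim: s z P => [|[y x] s IH] z P cP zP /=.
  move=> _ zz' z'P; rewrite andbT.
  have -> : #|P :\ z'| = N by have := cardsD1 z' P; rewrite z'P cP add1n => -[<-].
  rewrite eqxx /=.
  rewrite disjoints_subset setCS subD1set /= eq_sym setD1_inj //.
move=> /and4P[yP yz xP ex] la fin.
have cPy : #|P :\ y| = N by have := cardsD1 y P; rewrite yP cP add1n => -[<-].
have xPy : x \notin P :\ y by rewrite inE negb_and xP orbT.
have cP' : #|x |: P :\ y| = N.+1 by rewrite cardsU1 xPy cPy.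
rewrite cPy eqxx disjoints_subset setCS subD1set setD1_inj //=.
have cC : #|~: (x |: P :\ y)| = N by have := cardsC (x |: P :\ y); rewrite cardK cP'; lia.
rewrite cC eqxx disjoints_subset setCK subsetUr /=.
have -> : ~: (x |: P :\ y) != ~: P.
  by apply/eqP => /setP/(_ x); rewrite !inE eqxx (negPf xP).
have := IH x (x |: P :\ y) cP' _ ex la fin; rewrite setU1K //.
by apply; rewrite !inE eqxx.
Qed.

(** A neighbour of X in the odd graph is [~: X] minus a point, so prescribing U1 and V1 amounts to
    prescribing the points z and z' of [exchange_walk]. Each of its N exchanges gives two steps. *)
Lemma odd_walk_exists (U1 U V V1 : {set K}) : 3 <= N -> #|U1| = N -> #|U| = N -> #|V| = N -> #|V1| = N ->
    [disjoint U1 & U] -> [disjoint V & V1] ->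
  exists l, [/\ size l = N.*2, odd_walk U1 U (rcons l V1) & last U l = V].
Proof.
move=> N3 cU1 cU cV cV1 dU dV.
have compl (X Z : {set K}) : #|X| = N -> #|Z| = N -> [disjoint X & Z] ->
    exists2 z, z \in ~: X & Z = ~: X :\ z.
  move=> cX cZ; rewrite disjoint_sym disjoints_subset => ZX.
  have cCX : #|~: X| = N.+1 by have := cardsC X; rewrite cardK cX; lia.
  have /cards1P[z zE] : #|~: X :\: Z| == 1.
    by rewrite cardsD (setIidPr ZX) cCX cZ subSnn.
  have : z \in ~: X :\: Z by rewrite zE inE.
  rewrite inE => /andP[zZ zX]; exists z => //.
  by rewrite -zE setDDr setDv set0U (setIidPr ZX).
have dU' : [disjoint U & U1] by rewrite disjoint_sym.
have [z zU U1E] := compl U U1 cU cU1 dU'.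
have [z' zV V1E] := compl V V1 cV cV1 dV.
have cc (X : {set K}) : #|X| = N -> #|~: X| = N.+1.
  by move=> cX; have := cardsC X; rewrite cardK cX; lia.
have [s [ss ex fin la]] := exchange_walk z z' N3 (cc _ cU) (cc _ cV).
exists (walk_of (~: U) s); split.
- by rewrite size_walk_of ss.
- rewrite -[X in odd_walk _ X]setCK U1E V1E -fin; apply: odd_walk_of => //; first exact: cc.
  by rewrite fin.
- rewrite -[RHS]setCK -fin -[X in last X _]setCK.
  elim: (s) (~: U) => [|[y x] s0 IH] P //=.
Qed.

End OddGraphWalks.

(** * Extending odd colorings *)

Section Threads.
Variable T : finType.

(** Pigeonhole: k bad entries leave k + 1 runs, and if all were shorter than d, the size would be at
    most k + (k + 1)(d - 1). *)
Lemma long_run (P : pred T) (t : seq T) d : (count (predC P) t).+1 * d <= size t ->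
  exists t1 s t2, [/\ t = t1 ++ s ++ t2, size s = d & all P s].
Proof.
have prefix (t0 : seq T) : ~~ has (predC P) t0 -> d <= size t0 ->
    exists s t2, [/\ t0 = s ++ t2, size s = d & all P s].
  move=> np dt; exists (take d t0), (drop d t0); rewrite cat_take_drop size_takel //.
  split=> //; apply/allP => x /mem_take xt; move: np; rewrite has_predC negbK => /allP.
  exact.
move k : (count _ _) => n; elim: n t k => [|n IH] t k hs.
  have [||s [t2 [-> ss ps]]] := prefix t; last by exists [::], s, t2.
    by rewrite has_count k.
  by rewrite mul1n in hs.
have : has (predC P) t by rewrite has_count k.
move=> h; case/split_find: h k hs => x s1 s2 px np; rewrite -cats1 -catA /= => k hs.
case: (leqP d (size s1)) => ds.
  have [s [t2 [-> ss ps]]] := prefix s1 np ds.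
  by exists [::], s, (t2 ++ x :: s2); rewrite -catA.
have [||t1 [s [t2 [-> ss ps]]]] := IH s2.
- have {}px : ~~ P x := px; move: k np; rewrite count_cat /= px has_count -leqNgt leqn0.
  by move=> + /eqP s10; rewrite s10 add0n add1n => -[].
- by move: hs; rewrite size_cat /=; lia.
by exists (s1 ++ x :: t1), s, t2; rewrite -catA.
Qed.

Variable e : rel T.

Definition threaded (q : seq T) x0 (d : nat) : Prop :=
  [/\ size q = d.+2, uniq q, forall i, i <= d -> e (nth x0 q i) (nth x0 q i.+1) &
      forall i, 0 < i <= d -> deg e (nth x0 q i) <= 2].

(** Cut the cycle at a branch vertex if it has one. At most four others remain, which split the
    rest, of size at least 5d, into at most five runs. *)
Lemma thread_of_cycle (c : seq T) d x0 : ucycle e c -> 0 < d -> 5 * d < size c ->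
    count (fun x => 2 < deg e x) c <= 5 ->
  exists q, threaded q x0 d.
Proof.
move=> uc d0 sc hc.
have [x [t [ux [st ct]]]] : exists x t, ucycle e (x :: t) /\ (5 * d <= size t /\
    count (fun x => 2 < deg e x) t <= 4).
  case: (boolP (has (fun x => 2 < deg e x) c)) => [/hasP[x xc dx]|nh].
    have [i c' cE] := rot_to xc; exists x, c'; rewrite -cE.
    split; first by rewrite /ucycle rot_cycle rot_uniq.
    have := size_rot i c; rewrite cE /= => sE; split; first by rewrite -ltnS sE.
    have /permP cnt : perm_eq (rot i c) c by rewrite perm_rot.
    by move: hc; rewrite -cnt cE /= dx.
  case: c uc sc nh {hc} => // x t uc sc nh; exists x, t; split=> //; split=> //.
  by move: nh; rewrite has_count -leqNgt leqn0 /= addn_eq0 => /andP[_ /eqP ->].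
move: ux => /andP[cyc un].
have [|t1 [s [t2 [tE ss ps]]]] := @long_run (fun x => deg e x <= 2) t d.
  apply: leq_trans st; rewrite leq_mul2r; apply/orP; right; rewrite ltnS.
  apply: leq_trans ct; rewrite leq_eqVlt; apply/orP; left; apply/eqP.
  by apply: eq_count => z /=; rewrite -ltnNge.
(* The vertices flanking the run; a run at an end of t is flanked there by the cut point x. Since t
   is longer than s, this does not happen at both ends, and a differs from b. *)
pose a := last x t1; pose b := head x t2.
have [l1 [l2 E]] : exists l1 l2, x :: rcons t x = l1 ++ (a :: rcons s b) ++ l2.
  rewrite tE rcons_cat rcons_cat -cat_cons lastI -cats1 -catA /=.
  exists (belast x t1), (behead (rcons t2 x)); congr (_ ++ a :: _).
  rewrite cat_rcons; congr (s ++ _); by rewrite /b; case: (t2).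
have sq : size (a :: rcons s b) = d.+2 by rewrite /= size_rcons ss.
exists (a :: rcons s b); split=> //.
- rewrite /= rcons_uniq mem_rcons inE negb_or.
  have uxt : uniq (x :: t1 ++ s ++ t2) by rewrite -tE.
  have us : uniq s by move: uxt; rewrite -cat_cons cat_uniq [uniq (s ++ _)]cat_uniq => /and3P[_ _ /and3P[]].
  have as_ : a \notin s.
    move: uxt; rewrite -cat_cons cat_uniq => /and3P[_ /hasPn h _].
    by apply/negP => sa; have := h a; rewrite mem_cat sa => /(_ isT); rewrite mem_last.
  have bs : b \notin s.
    apply/negP => sb; rewrite /b in sb; move: uxt; case: (t2) sb => [|y t3] sb.
      by rewrite /= !mem_cat sb orbT.
    rewrite -cat_cons cat_uniq [uniq (s ++ _)]cat_uniq => /and3P[_ _ /and3P[_ /hasPn h _]].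
    by have := h y; rewrite inE eqxx (sb : y \in s) => /(_ isT).
  rewrite us as_ bs !andbT /a /b.
  case: t2 uxt tE {bs b E sq} => [|y t3] uxt tE /=.
    case/lastP: t1 uxt tE {as_ a} => [|t1 y] uxt tE /=.
      by move: st; rewrite tE /= cats0 ss; lia.
    rewrite last_rcons; apply: contraTneq uxt => ->.
    by rewrite /= mem_cat mem_rcons inE eqxx.
  apply/negP => /eqP E; move: uxt; rewrite -cat_cons catA cat_uniq => /and3P[_ /hasPn h _].
  by have := h y; rewrite inE eqxx => /(_ isT); rewrite -E mem_cat mem_last.
- move=> i hi; have pq : path e a (rcons s b).
    move: cyc; rewrite /= => p; have : sorted e (x :: rcons t x) by [].
    by rewrite E => /cat_sorted2[_ /cat_sorted2[]].
  by have /(pathP x0)/(_ i) := pq; rewrite size_rcons ss ltnS => /(_ hi).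
- case=> // i /andP[_ id] /=; rewrite nth_rcons ss id.
  by move/allP: ps => /(_ (nth x0 s i)); apply; rewrite mem_nth // ss.
Qed.

End Threads.

(** * Extension over a leaf and over a thread; the induction *)

Section Extension.
Variables (T K : finType) (N : nat).
Hypothesis cardK : #|K| = N.*2.+1.

(* A locally injective homomorphism to the odd graph; the colour of an edge xy
   is the unique element outside f x and f y. *)
Definition odd_coloring (e : rel T) (f : T -> {set K}) : Prop :=
  [/\ forall x, #|f x| = N,
      forall x y, e x y -> [disjoint f x & f y] &
      forall x y z, e x y -> e x z -> f y = f z -> y = z].

(** In the odd graph A has N + 1 neighbours, one more than F can exclude. *)
Lemma free_set (A : {set K}) (F : {set {set K}}) : #|A| = N -> #|F| <= N ->
  exists U : {set K}, [/\ #|U| = N, [disjoint A & U] & U \notin F].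
Proof.
move=> cA cF; have cCA : #|~: A| = N.+1 by have := cardsC A; rewrite cardK cA; lia.
pose S := [set ~: A :\ z | z in ~: A].
have cS : #|S| = N.+1.
  rewrite card_in_imset // => z z' zA z'A E; apply/eqP/negPn/negP => ne.
  by have := setD1_inj zA ne; rewrite E eqxx.
have [U] : exists U, U \in S :\: F.
  apply/set0Pn; rewrite -card_gt0 cardsD cS subn_gt0 ltnS.
  exact: leq_trans (subset_leq_card (subsetIr S F)) cF.
rewrite inE => /andP[UF /imsetP[z zA UE]]; exists U; split=> //.
  by have := cardsD1 z (~: A); rewrite zA cCA -UE add1n => -[<-].
by rewrite disjoint_sym disjoints_subset UE subD1set.
Qed.

Lemma odd_walk_nth U1 U (l : seq {set K}) i : odd_walk N U1 U l -> i < size l ->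
  [/\ #|nth set0 l i| = N, [disjoint nth set0 (U :: l) i & nth set0 l i] &
      nth set0 l i != nth set0 [:: U1, U & l] i].
Proof.
elim: l U1 U i => [|W l IH] U1 U i //= /and4P[/eqP cW d n w].
case: i => [|i] //=; rewrite ltnS => il.
by have [h1 h2 h3] := IH U W i w il.
Qed.

Variable e : rel T.
Hypotheses (e_sym : symmetric e) (e_irr : irreflexive e).

(** The vertex type stays fixed and the vertices of S become isolated, which keeps the induction on
    relations over T. *)
Definition remove_vertices (S : {set T}) : rel T := [rel u v | [&& e u v, u \notin S & v \notin S]].

Lemma card_free (f : T -> {set K}) x y : e x y -> deg e x <= N.+1 ->
  #|f @: ([set w | e x w] :\ y)| <= N.
Proof.
move=> xy dx; apply: leq_trans (leq_imset_card _ _) _.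
by move: dx; rewrite /deg (cardsD1 y) inE xy.
Qed.

(** The new set U must be disjoint from [f y] and differ from the sets of the at most N other
    neighbours of y. *)
Lemma extend_leaf f x y : e x y -> (forall z, e x z -> z = y) -> deg e y <= N.+1 ->
  odd_coloring (remove_vertices [set x]) f -> exists g, odd_coloring e g.
Proof.
move=> xy only dy [f1 f2 f3].
have yx : e y x by rewrite e_sym.
have xny : x != y by apply: contraTneq xy => ->; rewrite e_irr.
have [U [cU dU UF]] := free_set (f1 y) (card_free f yx dy).
exists (fun u => if u == x then U else f u).
have rem u v : e u v -> u != x -> v != x -> remove_vertices [set x] u v.
  by move=> uv ux vx; rewrite /remove_vertices /= uv !inE ux vx.
have newU z : e y z -> z != x -> U != f z.
  move=> yz zx; apply: contraNneq UF => ->; apply: imset_f.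
  by rewrite !inE zx yz.
split=> [u|u v uv|u v w uv uw].
- by case: eqP.
- case: (eqVneq u x) uv => [->|ux] uv; case: (eqVneq v x) uv => [->|vx] uv.
  + by rewrite e_irr in uv.
  + by rewrite (only v uv) disjoint_sym.
  + by rewrite e_sym in uv; rewrite (only u uv).
  + by apply: f2; apply: rem.
- case: (eqVneq u x) uv uw => [->|ux] uv uw; first by rewrite (only v uv) (only w uw).
  case: (eqVneq v x) uv => [->|vx] uv; case: (eqVneq w x) uw => [->|wx] uw //.
  + have uy : u = y by apply: only; rewrite e_sym.
    by move=> E; have := newU w; rewrite -uy E eqxx => /(_ uw wx).
  + have uy : u = y by apply: only; rewrite e_sym.
    by move=> E; have := newU v; rewrite -uy E eqxx => /(_ uv vx).
  + by apply: (f3 u); apply: rem.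
Qed.

Hypothesis N3 : 3 <= N.

(** Free sets U at p 1 and V at p d keep the coloring injective around the two ends. The interior
    follows a non-backtracking walk of d - 1 = 2N steps from U to V, entered from [f (p 0)] and left
    towards [f (p d.+1)]; not backtracking is local injectivity at the interior vertices. *)
Lemma extend_thread f q x0 (d := N.*2.+1) (S := [set x | (x \in q) && (0 < index x q < d.+1)]) :
    threaded e q x0 d -> (forall x, deg e x <= N.+1) ->
    odd_coloring (remove_vertices S) f -> exists g, odd_coloring e g.
Proof.
move=> [sq uq pq dq] dmax [f1 f2 f3].
pose p i := nth x0 q i.
have p_inj i j : i < d.+2 -> j < d.+2 -> p i = p j -> i = j.
  by move=> hi hj /eqP; rewrite nth_uniq ?sq // => /eqP.
have pS i : i < d.+2 -> (p i \in S) = (0 < i < d.+1).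
  by move=> hi; rewrite inE mem_nth ?sq // index_uniq ?sq.
have Sp x : x \in S -> exists2 i, 0 < i < d.+1 & x = p i.
  by rewrite inE => /andP[xq hi]; exists (index x q); rewrite // /p nth_index.
have pp i : i < d.+1 -> e (p i) (p i.+1) by move=> hi; apply: pq.
have nbr i v : i < d -> e (p i.+1) v -> v = p i \/ v = p i.+2.
  move=> hi ev; have e1 : e (p i.+1) (p i) by rewrite e_sym; apply: pp; lia.
  have e2 : e (p i.+1) (p i.+2) by apply: pp.
  have ne : p i.+2 != p i by apply/eqP => /p_inj h; have := h _ _; lia.
  have := dq i.+1; rewrite /= => /(_ hi); rewrite /deg (cardsD1 (p i)) inE e1.
  rewrite (cardsD1 (p i.+2)) !inE ne e2 /= !add1n !ltnS leqn0 cards_eq0 => /eqP/setP/(_ v).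
  by rewrite !inE ev andbT; case: (eqVneq v (p i)) => [->|_]; [left | case: eqP => // ->; right].
have cross x y : e x y -> x \notin S -> y \in S ->
    (x = p 0 /\ y = p 1) \/ (x = p d.+1 /\ y = p d).
  move=> xy xS /Sp[[|i] // hi yE]; rewrite yE e_sym in xy.
  case: (nbr i x _ xy) => // xE; rewrite xE pS in xS; try lia.
    by left; rewrite xE yE; have -> : i = 0 by lia.
  by right; rewrite xE yE; have -> : i.+1 = d by lia.
have dT : 0 < d by [].
have [U [cU dU UF]] := free_set (f1 (p 0)) (card_free f (pp 0 isT) (dmax _)).
have e_last : e (p d.+1) (p d) by rewrite e_sym; apply: pp.
have [V [cV dV VF]] := free_set (f1 (p d.+1)) (card_free f e_last (dmax _)).
rewrite disjoint_sym in dV.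
have [l [sl wl ll]] := odd_walk_exists cardK N3 (f1 _) cU cV (f1 _) dU dV.
(* Entry i of L is the set at p i, for i from 0 to d.+1. *)
pose L := [:: f (p 0), U & rcons l (f (p d.+1))].
have Ld : nth set0 L d = V.
  rewrite -[LHS]/(nth set0 (rcons (U :: l) (f (p d.+1))) N.*2).
  by rewrite nth_rcons /= sl ltnS leqnn -ll (last_nth set0) sl.
have sr : size (rcons l (f (p d.+1))) = d by rewrite size_rcons sl.
have Ln j : j < d -> [/\ #|nth set0 L j.+2| = N, [disjoint nth set0 L j.+1 & nth set0 L j.+2] &
    nth set0 L j.+2 != nth set0 L j].
  by rewrite -{1}sr => hj; apply: odd_walk_nth wl hj.
have Lend : nth set0 L d.+1 = f (p d.+1).
  rewrite -[LHS]/(nth set0 (rcons l (f (p d.+1))) N.*2).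
  by rewrite nth_rcons sl ltnn eqxx.
have L_disj j : j < d.+1 -> [disjoint nth set0 L j & nth set0 L j.+1].
  by case: j => [|j] // hj; have [] := Ln j hj.
have L_card j : j < d.+2 -> #|nth set0 L j| = N.
  case: j => [|[|j]] hj; [exact: f1 | exact: cU | by have [] := Ln j hj].
pose g u := if u \in S then nth set0 L (index u q) else f u.
have gp i : i < d.+2 -> g (p i) = nth set0 L i.
  move=> hi; rewrite /g pS //; case: ifP => h; first by rewrite index_uniq ?sq.
  case: i hi h => [|i] // hi h; have -> : i = d by lia.
  by rewrite Lend.
have g_out x : x \notin S -> g x = f x by rewrite /g => /negbTE ->.
have inj_in x y z : x \in S -> e x y -> e x z -> g y = g z -> y = z.
  move=> /Sp[[|i] // hi ->] xy xz; have id : i < d by [].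
  have [_ _ /eqP Lne] := Ln i id.
  have i0 : i < d.+2 by rewrite ltnW // ltnW.
  have i2 : i.+2 < d.+2 by [].
  by case: (nbr i y id xy) => ->; case: (nbr i z id xz) => ->; rewrite // !gp // => h;
    case: Lne; rewrite h.
have mixed x y z : e x y -> e x z -> x \notin S -> y \in S -> z \notin S -> g y != g z.
  move=> xy xz xS yS zS; rewrite (g_out z) //.
  case: (cross x y xy xS yS) => -[xE yE].
    rewrite yE gp // (_ : nth _ _ _ = U) //; apply: contraNneq UF => ->; apply: imset_f.
    by rewrite !inE -xE xz andbT; apply: contraNneq zS => ->; rewrite -yE.
  rewrite yE gp // Ld; apply: contraNneq VF => ->; apply: imset_f.
  by rewrite !inE -xE xz andbT; apply: contraNneq zS => ->; rewrite -yE.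
have disj_in x y : x \in S -> e x y -> [disjoint g x & g y].
  move=> /Sp[[|i] // hi ->] xy; have id : i < d by [].
  have i0 : i < d.+1 by rewrite ltnW.
  have i1 : i < d.+2 by rewrite ltnW.
  case: (nbr i y id xy) => ->; rewrite (gp i.+1 i0).
    by rewrite (gp i i1) disjoint_sym L_disj.
  by rewrite (gp i.+2) ?L_disj.
exists g; split=> [x|x y xy|x y z xy xz].
- case: (boolP (x \in S)) => [/Sp[i /andP[_ hi] ->]|xS]; last by rewrite g_out.
  by rewrite gp ?L_card // ltnW.
- case: (boolP (x \in S)) => xS; first exact: disj_in.
  case: (boolP (y \in S)) => yS; first by rewrite disjoint_sym disj_in // e_sym.
  by rewrite !g_out //; apply: f2; rewrite /remove_vertices /= xy xS yS.
- case: (boolP (x \in S)) => xS; first exact: (inj_in x).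
  case: (boolP (y \in S)) => yS; case: (boolP (z \in S)) => zS E.
  + case: (cross x y xy xS yS) => -[xE ->]; case: (cross x z xz xS zS) => -[xE' ->] //.
      by have := p_inj 0 d.+1; rewrite -xE -xE' => /(_ isT (ltnSn _) erefl).
    by have := p_inj d.+1 0; rewrite -xE -xE' => /(_ (ltnSn _) isT erefl).
  + by case/eqP: (mixed x y z xy xz xS yS zS).
  + by have := mixed x z y xz xy xS zS yS; rewrite E eqxx.
  + by apply: (f3 x); rewrite /remove_vertices /= ?xy ?xz ?xS ?yS ?zS // -?g_out.
Qed.

End Extension.

Lemma deg_sub (T : finType) (e e' : rel T) x : subrel e' e -> deg e' x <= deg e x.
Proof. by move=> sub; apply/subset_leq_card/subsetP => y; rewrite !inE; apply: sub. Qed.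

(** Induction on the number of darts of a subgraph: the bounds on degree and girth and the corner
    systems are inherited. A vertex of degree 1 is removed as a leaf; otherwise a cycle with few
    branch vertices provides a thread. *)
Lemma odd_coloring_exists (T K : finType) (N : nat) (e0 : rel T) :
    #|K| = N.*2.+1 -> 3 <= N -> symmetric e0 -> irreflexive e0 ->
    (forall x, deg e0 x <= N.+1) ->
    (forall c, ucycle e0 c -> 2 < size c -> 10 * N + 6 <= size c) ->
    (forall e : rel T, symmetric e -> subrel e e0 -> exists C, corner_system e C) ->
  exists f : T -> {set K}, odd_coloring N e0 f.
Proof.
move=> cardK N3 sym0 irr0 deg0 girth0 corners.
suff main n (e : rel T) : #|[set a : T * T | e a.1 a.2]| <= n -> symmetric e -> subrel e e0 ->
    exists f : T -> {set K}, odd_coloring N e f by exact: (main _ e0 (leqnn _)).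
elim: n e => [|n IH] e cn e_sym sub.
all: have e_irr : irreflexive e by move=> x; apply/negP => /sub; rewrite irr0.
all: have emax x : deg e x <= N.+1 by exact: leq_trans (deg_sub x sub) (deg0 x).
  have none x y : e x y = false.
    apply/negP => xy; move: cn; rewrite leqn0 cards_eq0 => /eqP/setP/(_ (x, y)).
    by rewrite !inE xy.
  have [A] : exists A : {set K}, A \in [set A : {set K} | #|A| == N].
    by apply/set0Pn; rewrite -card_gt0 card_draws cardK bin_gt0; lia.
  rewrite inE => /eqP cA; exists (fun=> A).
  by split=> [x|x y|x y z]; rewrite ?none.
have smaller (S : {set T}) x y : x \in S -> e x y ->
    exists f : T -> {set K}, odd_coloring N (remove_vertices e S) f.
  move=> xS xy; apply: IH.
  - rewrite -ltnS; apply: leq_trans cn; apply: proper_card; apply/properP; split.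
      by apply/subsetP => -[u v]; rewrite !inE => /and3P[].
    by exists (x, y); rewrite !inE /remove_vertices /= ?xS //= andbF.
  - by move=> u v; rewrite /remove_vertices /= e_sym; congr andb; rewrite andbC.
  - by move=> u v /and3P[/sub].
case: (pickP (fun a : T * T => e a.1 a.2)) => [[x0 y0] /= xy0|none]; last first.
  apply: IH => //; rewrite (_ : [set _ | _] = set0) ?cards0 //.
  by apply/setP => a; rewrite !inE none.
case: (pickP (fun a : T * T => e a.1 a.2 && (deg e a.1 <= 1))) => [[x y] /= /andP[xy d1]|branch].
  have [f fP] := smaller [set x] x y (set11 x) xy.
  apply: (extend_leaf cardK e_sym e_irr xy _ (emax y) fP) => z xz.
  apply/eqP; apply: contraTT d1 => zy; rewrite -ltnNge /deg (cardsD1 y) inE xy.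
  by rewrite (cardsD1 z) !inE zy xz.
have deg2 x y : e x y -> 1 < deg e x.
  by move=> xy; have := branch (x, y); rewrite /= xy /= ltnNge => ->.
have [C CP] := corners e e_sym sub.
have [c [uc sc fc]] := cycle_with_few_branch_vertices e_sym e_irr CP deg2 xy0.
have gc : 10 * N + 6 <= size c.
  apply: girth0 => //; case/andP: uc => cc uc; rewrite /ucycle uc andbT.
  case: c cc {uc sc fc} => //= x c; exact: sub_path.
(* A run of 2N + 1 vertices needs a cycle of more than 5(2N + 1) = 10N + 5 vertices, which is
   exactly the girth bound. *)
have h5 : 5 * N.*2.+1 < size c by rewrite -muln2; lia.
have [q qP] := thread_of_cycle x0 uc (ltn0Sn _) h5 fc.
have [sq uq pq dq] := qP.
set S := [set x | (x \in q) && (0 < index x q < N.*2.+2)].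
have xS : nth x0 q 1 \in S by rewrite inE mem_nth ?sq // index_uniq ?sq.
have [f fP] := smaller S _ _ xS (pq 1 isT).
exact: (extend_thread cardK e_sym N3 qP emax fP).
Qed.

From mathcomp Require Import all_classical all_reals all_analysis.
Import numFieldNormedType.Exports.

(** * From arcs to polygons *)

Section Topology.
Local Open Scope ring_scope.
Local Open Scope classical_set_scope.
Variable R : realType.

(** The difference set of A and B is compact and misses 0, so its complement contains a ball around
    0. *)
Lemma compact_gap (A B : set (R * R)) : compact A -> compact B ->
  A `&` B = set0 -> exists2 d, 0 < d & forall a b, A a -> B b -> d <= `|a - b|.
Proof.
move=> cA cB AB.
pose D := [set ab.1 - ab.2 | ab in A `*` B].
have cD : compact D.
  apply: continuous_compact; last exact: compact_setX.
  apply: continuous_subspaceT => ab.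
  by apply: cvgB; [exact: cvg_fst | exact: cvg_snd].
have oD : open (~` D).
  by apply: closed_openC; apply: compact_closed => //; exact: norm_hausdorff.
have : nbhs (0 : R * R) (~` D).
  apply: open_nbhs_nbhs; split => // -[[a b] [/= Aa Bb]] /eqP.
  rewrite subr_eq0 => /eqP ab; have : (A `&` B) a by split=> //; rewrite ab.
  by rewrite AB.
move=> /nbhs_ballP [d /= d0 Hd]; exists d => // a b Aa Bb.
rewrite leNgt; apply/negP => lt; apply: (Hd (a - b)); last by exists (a, b).
by rewrite -ball_normE /= /ball_ /= sub0r normrN.
Qed.

(** Composition with this retraction onto [0, 1] turns continuity within the interval into
    continuity on the whole line. *)
Definition clamp (t : R) : R := Num.max 0 (Num.min t 1).

Lemma clamp_itv t : 0 <= clamp t <= 1.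
Proof. by rewrite le_max lexx ge_max ler01 ge_min lexx orbT. Qed.

Lemma clamp_id t : 0 <= t <= 1 -> clamp t = t.
Proof. by move=> /andP[t0 t1]; rewrite /clamp min_l // max_r. Qed.

Lemma clamp_lipschitz s t : `|clamp s - clamp t| <= `|s - t|.
Proof.
have key a b : a <= b -> 0 <= clamp b - clamp a <= b - a.
  move=> ab; rewrite /clamp; have l1 : (0 : R) <= 1 := ler01.
  by case: (lerP b 1) => ?; case: (lerP a 1) => ?; rewrite ?(max_r l1);
    case: (lerP 0 b) => ?; case: (lerP 0 a) => ?; apply/andP; split; lra.
have [/key/andP[h1 h2]|/ltW/key/andP[h1 h2]] := lerP s t.
  by rewrite distrC ger0_norm; lra.
by rewrite ger0_norm; lra.
Qed.

Lemma continuous_clamp (f : R -> R * R) :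
  {within `[0, 1], continuous f} -> continuous (f \o clamp).
Proof.
move=> /subspace_continuousP cf t; apply/cvgrPdist_lt => eps eps0.
have h : `[0, 1]%classic (clamp t) by rewrite /= in_itv /= clamp_itv.
have /cvgrPdist_lt/(_ _ eps0)/nbhs_ballP[d /= d0 Hd] := cf _ h.
apply/nbhs_ballP; exists d => //= s ts.
apply: Hd; last by rewrite /= in_itv /= clamp_itv.
rewrite -ball_normE /=; exact: le_lt_trans (clamp_lipschitz _ _) ts.
Qed.

(** Take the largest time with g <= r, attained because these times form a closed set; if g were
    below r there, the intermediate value theorem would give a later one. *)
Lemma last_exit (g : R -> R) (a b r : R) : continuous g -> a <= b ->
  g a <= r -> r < g b ->
  exists2 c, a <= c < b & g c = r /\ forall t, c <= t <= b -> r <= g t.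
Proof.
move=> cg ab ga gb.
pose A := [set t | a <= t <= b /\ g t <= r].
have A0 : A !=set0 by exists a; rewrite /A /= lexx ab.
have hub : has_ubound A by exists b => t [/andP[]].
have supA : has_sup A by [].
pose c := sup A.
have cA : A c.
  have clA : closed A.
    have -> : A = `[a, b]%classic `&` (g @^-1` [set x | x <= r]).
      by apply/seteqP; split=> t; rewrite /A /= in_itv.
    apply: closedI; first exact: interval_closed.
    by apply: closed_comp; [move=> ? _; exact: cg | exact: closed_le].
  by apply: clA; apply: closure_sup.
have max t : A t -> t <= c by move=> At; apply: ub_le_sup.
have [/andP[ac cb] gc] := cA.
have cb' : c < b by rewrite lt_neqAle cb andbT; apply: contraTneq gb => <-; rewrite -leNgt.
have after t : c < t <= b -> r < g t.
  move=> /andP[ct tb]; rewrite ltNge; apply/negP => gt.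
  have : t <= c by apply: max; split=> //; rewrite tb andbT; lra.
  by rewrite leNgt ct.
have gcr : g c = r.
  have [||x] := @IVT R g c b r cb; first by apply: continuous_subspaceT.
    by rewrite ge_min gc le_max (ltW gb) orbT.
  rewrite in_itv /= => /andP[cx xb] gx.
  case: (eqVneq c x) => [->//|cx'].
  by have := @after x; rewrite lt_neqAle cx' cx xb gx ltxx => /(_ isT).
exists c; first by rewrite ac cb'.
split=> // t /andP[]; rewrite le_eqVlt => /orP[/eqP <- _|ct tb]; first by rewrite gcr.
by apply: ltW; apply: after; rewrite ct tb.
Qed.

(** t0 is the last exit from the ball around F 0, and t1 the first entry after t0 into the ball
    around F 1, found as a last exit in reversed time. *)
Lemma middle_arc (F : R -> R * R) (r : R) : continuous F -> 0 < r ->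
  2 * r < `|F 1 - F 0| ->
  exists t0 t1, [/\ 0 < t0, t0 < t1 & t1 < 1] /\
    [/\ `|F t0 - F 0| = r, `|F t1 - F 1| = r &
    forall t, t0 <= t <= t1 -> r <= `|F t - F 0| /\ r <= `|F t - F 1|].
Proof.
move=> cF r0 far.
have cdist (c : R * R) : continuous (fun t => `|F t - c|).
  by move=> t; apply: cvg_norm; apply: cvgB; [exact: cF | exact: cvg_cst].
have [|||t0 /andP[t00 t01] [h0 after0]] := @last_exit (fun t => `|F t - F 0|) 0 1 r (cdist _).
- exact: ler01.
- by rewrite subrr normr0 ltW.
- lra.
have [||||s /andP[s0 s1] [hs after1]] := @last_exit (fun t => `|F (- t) - F 1|) (- 1) (- t0) r.
- move=> t; apply: (@continuous_comp _ _ _ -%R (fun t => `|F t - F 1|)); last exact: cdist.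
  exact: opp_continuous.
- by rewrite lerN2 ltW.
- by rewrite opprK subrr normr0 ltW.
- rewrite opprK.
  have := ler_normB (F t0 - F 0) (F t0 - F 1).
  by rewrite opprB addrC subrKA h0; lra.
exists t0, (- s); split; split => //.
- rewrite lt_neqAle t00 andbT; apply: contraTneq r0 => E.
  by rewrite -h0 -E subrr normr0 ltxx.
- lra.
- rewrite lt_neqAle lerNl s0 andbT; apply: contraTneq r0 => E.
  by rewrite -hs E subrr normr0 ltxx.
- move=> t /andP[h1 h2]; split; first by apply: after0; rewrite h1 /=; lra.
  by have := after1 (- t); rewrite opprK; apply; apply/andP; split; lra.
Qed.

(** Continuous induction: at the supremum c of the times reached by such chains, continuity allows
    one more side to c, and past c if c < b. *)
Lemma fine_chain (F : R -> R * R) (a b d : R) : continuous F -> a <= b -> 0 < d ->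
  exists l, last (F a) l = F b /\ forall u v, (u, v) \in sides (F a) l ->
    (exists2 t, a <= t <= b & u = F t) /\ `|v - u| < d.
Proof.
move=> cF ab d0.
pose good c := exists l, last (F a) l = F c /\ forall u v, (u, v) \in sides (F a) l ->
    (exists2 t, a <= t <= b & u = F t) /\ `|v - u| < d.
have extend s t : a <= s <= b -> good s -> `|F t - F s| < d -> good t.
  move=> sab [l [ll hl]] st; exists (rcons l (F t)); rewrite last_rcons; split=> // u v.
  have -> : sides (F a) (rcons l (F t)) = rcons (sides (F a) l) (F s, F t).
    rewrite -ll; elim: (l) (F a) => [|b0 l0 IH] a0 //=.
    by rewrite /sides /= -/(sides b0 (rcons l0 (F t))) IH.
  rewrite mem_rcons inE => /orP[/eqP[-> ->]|]; last exact: hl.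
  by split=> //; exists s.
pose A := [set t | a <= t <= b /\ good t].
have Aa : A a by split; [rewrite lexx ab | exists nil].
have A0 : A !=set0 by exists a.
have hub : has_ubound A by exists b => t [/andP[]].
have supA : has_sup A by [].
pose c := sup A.
have ac : a <= c by apply: ub_le_sup.
have cb : c <= b by apply: ge_sup => // t [/andP[]].
have d20 : 0 < d / 2 by rewrite divr_gt0.
have := cF c; move/cvgrPdist_lt/(_ _ d20)/nbhs_ballP => [e /= e0 He].
have He' t : `|c - t| < e -> `|F c - F t| < d / 2.
  by move=> h; apply: He; rewrite -ball_normE.
have [s [sab gs] sc] := sup_adherent e0 supA.
rewrite -/c in sc; have sc' : s <= c by apply: ub_le_sup.
have gc : good c.
  apply: (extend s) => //; apply: lt_trans (He' s _) _; last by lra.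
  by rewrite ger0_norm; lra.
suff bc : b = c by move: gc; rewrite -bc.
apply/eqP; rewrite eq_le cb andbT leNgt; apply/negP => cb'.
pose t := Num.min b (c + e / 2).
have ct : c < t by rewrite lt_min cb' ltrDl divr_gt0.
have tb : t <= b by rewrite ge_min lexx.
have te : t <= c + e / 2 by rewrite ge_min lexx orbT.
clearbody t.
have : t <= c.
  apply: ub_le_sup => //; split; first by rewrite tb andbT; lra.
  apply: (extend c) => //; first by rewrite ac cb.
  rewrite distrC; apply: lt_trans (He' t _) _; last by lra.
  by rewrite distrC ger0_norm; lra.
by rewrite leNgt ct.
Qed.

End Topology.

(** * The polygonal drawing obtained from a plane drawing *)

Section Assembly.
Local Open Scope ring_scope.
Local Open Scope classical_set_scope.
Variable R : realType.

Lemma finite_common_bound (I : finType) (P : I -> R -> Prop) :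
    (forall i d d', 0 < d' -> d' <= d -> P i d -> P i d') ->
    (forall i, exists d, 0 < d /\ P i d) ->
  exists2 d, 0 < d & forall i, P i d.
Proof.
move=> mono ex; have [f Hf] := choice ex.
have f0 i : xpredT i -> 0 < f i by have [] := Hf i.
have [d d0 Hd] := finite_lower_bound f0; exists d => // i.
by apply: (mono i (f i)) => //; [exact/ltW/Hd | have [] := Hf i].
Qed.

Lemma seg_ptE (a b : R * R) t : seg_pt a b t = a + t *: (b - a).
Proof. by apply: injective_projections. Qed.

Lemma in_boxE (o u : R * R) rho : in_box o rho u = (`|u - o| < rho).
Proof. by rewrite /in_box prod_normE gt_max. Qed.

Definition linked (M : set (R * R)) d a b := exists l, last a l = b /\
  forall u v, (u, v) \in sides a l -> M u /\ `|v - u| < d.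

Variable G : sgraph.
Variables (p : G -> R * R) (gamma : {set G} -> R -> R * R).
Hypothesis D : plane_drawing p gamma.

Lemma adj_neq (x y : G) : adj x y -> x != y.
Proof. by apply: contraTneq => ->; rewrite adj_irr. Qed.

Lemma edge_set2 (x y : G) : adj x y -> [set x; y]%SET \in edges G.
Proof. by move=> xy; rewrite inE; apply/existsP; exists x; apply/existsP; exists y; rewrite xy eqxx. Qed.

Lemma set2_same_edge (x y x' y' : G) :
  ([set x; y]%SET == [set x'; y']%SET) -> same_edge x y x' y'.
Proof.
move=> /eqP E; have := E; move/setP => E'.
have := E' x; have := E' y; have := E' x'; have := E' y'.
rewrite !inE !eqxx ?orbT /= /same_edge (eq_sym x' x) (eq_sym y' x) (eq_sym x' y) (eq_sym y' y).
by case: (x == x'); case: (x == y'); case: (y == x'); case: (y == y').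
Qed.

(** [drawing_arc_ends] does not say which end [gamma f 0] represents, so the arc is reversed when
    necessary. *)
Lemma oriented_arc (x y : G) : adj x y -> exists F : R -> R * R,
  [/\ continuous F, F 0 = p x, F 1 = p y,
      forall t, 0 <= t <= 1 -> (gamma [set x; y]%SET @` `[0, 1]) (F t) &
      forall t, 0 < t < 1 -> (gamma [set x; y]%SET @` `]0, 1[) (F t)].
Proof.
move=> xy; have fE := edge_set2 xy; set f := [set x; y]%SET in fE *.
have cf := continuous_clamp (drawing_arc_continuous D fE).
have ends := drawing_arc_ends D fE.
have i0 : (0 : R) \in `[0, 1] by apply/mem_set; rewrite /= in_itv /= lexx ler01.
have i1 : (1 : R) \in `[0, 1] by apply/mem_set; rewrite /= in_itv /= lexx ler01.
have n01 : gamma f 0 <> gamma f 1.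
  by move/(drawing_arc_inj D fE i0 i1)/eqP; rewrite eq_sym oner_eq0.
have c0 : clamp 0 = 0 :> R by apply: clamp_id; rewrite lexx ler01.
have c1 : clamp 1 = 1 :> R by apply: clamp_id; rewrite lexx ler01.
have end_in z : z = gamma f 0 \/ z = gamma f 1 -> z = p x \/ z = p y.
  move=> zf; have : (p @` [set` f]) z by rewrite -ends; case: zf => ->; [left|right].
  by case=> w /=; rewrite /f !inE => /orP[/eqP ->|/eqP ->] <-; [left|right].
case: (end_in (gamma f 0)) => [|e0|e0]; first by left.
  have e1 : gamma f 1 = p y by case: (end_in (gamma f 1)) => // [|h]; [right|rewrite e0 h in n01].
  exists (gamma f \o @clamp R); split => //=; rewrite ?c0 ?c1 //.
    by move=> t ht; exists t; rewrite /= ?in_itv //= clamp_id.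
  move=> t /andP[t0 t1]; exists t; first by rewrite /= in_itv /= t0.
  by rewrite clamp_id // !ltW.
have e1 : gamma f 1 = p x by case: (end_in (gamma f 1)) => // [|h]; [right|rewrite e0 h in n01].
exists ((gamma f \o @clamp R) \o (fun t => 1 - t)); split => /=; rewrite ?subr0 ?subrr ?c0 ?c1 //.
- move=> t; apply: continuous_comp; last exact: cf.
  by apply: cvgB; [exact: cvg_cst | exact: cvg_id].
- move=> t /andP[t0 t1]; have h : 0 <= 1 - t <= 1 by apply/andP; split; lra.
  by exists (1 - t); rewrite /= ?in_itv //= clamp_id.
- move=> t /andP[t0 t1]; have h : 0 <= 1 - t <= 1 by apply/andP; split; lra.
  exists (1 - t); last by rewrite clamp_id.
  by rewrite /= in_itv /=; apply/andP; split; lra.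
Qed.

(** [A.1.1] is a stretch of the arc outside the boxes of radius r around its ends; [A.1.2] and [A.2]
    are its extremities next to x and y. *)
Record middle_part (r : R) (x y : G) (A : set (R * R) * (R * R) * (R * R)) : Prop :=
  MiddlePart {
    mid_compact : compact A.1.1;
    mid_arc : A.1.1 `<=` gamma [set x; y]%SET @` `]0, 1[;
    mid_left : A.1.1 A.1.2 /\ `|A.1.2 - p x| = r;
    mid_right : A.1.1 A.2 /\ `|A.2 - p y| = r;
    mid_far : forall u, A.1.1 u -> r <= `|u - p x| /\ r <= `|u - p y|;
    mid_linked : forall d, 0 < d ->
      linked A.1.1 d A.1.2 A.2 /\ linked A.1.1 d A.2 A.1.2 }.

Lemma middle_part_sym r x y M a b :
  middle_part r x y (M, a, b) -> middle_part r y x (M, b, a).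
Proof.
move=> [h1 h2 h3 h4 h5 h6]; split => //=; first by rewrite finset.setUC.
  by move=> u /h5[].
by move=> d /h6[].
Qed.

Lemma middle_part_exists r x y : adj x y -> 0 < r -> 2 * r < `|p x - p y| ->
  exists A, middle_part r x y A.
Proof.
move=> xy r0 far; have [F [cF F0 F1 _ Fi]] := oriented_arc xy.
have [|t0 [t1 [[h0 h01 h1] [q0 q1 Fr]]]] := middle_arc cF r0.
  by rewrite F0 F1 distrC.
have it : forall t, `[t0, t1]%classic t <-> t0 <= t <= t1 by move=> t; rewrite /= in_itv.
exists (F @` `[t0, t1], F t0, F t1); split => /=.
- by apply: continuous_compact; [exact: continuous_subspaceT | exact: segment_compact].
- move=> _ [t /it/andP[a b] <-]; apply: Fi; apply/andP; split; lra.
- by split; [exists t0 => //; apply/it; rewrite lexx ltW | rewrite -F0].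
- by split; [exists t1 => //; apply/it; rewrite lexx ltW | rewrite -F1].
- by move=> _ [t /it ht <-]; have := Fr t ht; rewrite F0 F1.
- move=> d d0; split.
    have [l [ll hl]] := fine_chain cF (ltW h01) d0; exists l; split=> // u v uv.
    by have [[t ht ->] ?] := hl u v uv; split=> //; exists t => //; apply/it.
  have cF' : continuous (F \o -%R).
    by move=> t; apply: continuous_comp; [exact: opp_continuous | exact: cF].
  have t10 : - t1 <= - t0 by rewrite lerN2 ltW.
  have [l] := fine_chain cF' t10 d0; rewrite /= !opprK => -[ll hl].
  exists l; split=> // u v uv; have [[t /andP[a b] ->] ?] := hl u v uv; split=> //.
  by exists (- t) => //; apply/it; apply/andP; split; lra.
Qed.

(** Arcs are compact and miss the vertices that are not their ends, and there are finitely many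
    pairs. *)
Lemma vertex_radius : exists r : R, [/\ 0 < r,
  forall x x' : G, x != x' -> 2 * r < `|p x - p x'| &
  forall f w, f \in edges G -> w \notin f ->
    forall t, 0 <= t <= 1 -> r < `|gamma f t - p w|].
Proof.
have [||r1 r10 H1] := @finite_common_bound (G * G)%type
    (fun a d => a.1 != a.2 -> 2 * d < `|p a.1 - p a.2|).
- by move=> [x x'] d d' /= _ le h /h; apply: le_lt_trans; lra.
- move=> [x x'] /=; case: (eqVneq x x') => [->|n]; first by exists 1.
  have h0 : 0 < `|p x - p x'|.
    by rewrite normr_gt0 subr_eq0; apply: contra n => /eqP/(drawing_vertex_inj D) ->.
  exists (`|p x - p x'| / 3); split; first by rewrite divr_gt0.
  by move=> _; lra.
have [||r2 r20 H2] := @finite_common_bound ({set G} * G)%type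
    (fun a d => a.1 \in edges G -> a.2 \notin a.1 ->
       forall t, 0 <= t <= 1 -> d < `|gamma a.1 t - p a.2|).
- by move=> [f w] d d' /= _ le h fE wf t ht; apply: le_lt_trans (h fE wf t ht).
- move=> [f w] /=; case: (boolP (f \in edges G)) => [fE|_]; last by exists 1.
  case: (boolP (w \in f)) => [_|wf]; first by exists 1.
  have cf : compact (gamma f @` `[0, 1]).
    by apply: continuous_compact; [exact: (drawing_arc_continuous D fE) | exact: segment_compact].
  have [|d d0 Hd] := @compact_gap R _ _ cf (@compact_set1 _ (p w)).
    rewrite -subset0 => u [[t]]; rewrite /= in_itv /= => /andP[t0 t1] <- gw.
    have ends := drawing_arc_ends D fE.
    have wr : range p (gamma f t) by exists w.
    have inr z : gamma f z = p w -> (z = 0 \/ z = 1) -> False.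
      move=> E hz; have : (p @` [set` f]) (p w).
        by rewrite -ends -E; case: hz => ->; [left|right].
      by case=> w' /= w'f /(drawing_vertex_inj D) ww; rewrite -ww w'f in wf.
    move: t0; rewrite le_eqVlt => /orP[/eqP E|t0]; first by apply: (inr t) => //; left.
    move: t1; rewrite le_eqVlt => /orP[/eqP E|t1]; first by apply: (inr t) => //; right.
    have : (gamma f @` `]0, 1[ `&` range p) (gamma f t).
      by split=> //; exists t; rewrite //= in_itv /= t0.
    by rewrite (drawing_arc_vertex D fE).
  exists (d / 2); split; first by rewrite divr_gt0.
  move=> _ _ t ht; have im : (gamma f @` `[0, 1]) (gamma f t).
    by exists t; rewrite //= in_itv.
  have := Hd _ (p w) im erefl; lra.
exists (Num.min r1 r2); split; first by rewrite lt_min r10.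
- move=> x x' n; apply: le_lt_trans (H1 (x, x') n).
  by rewrite ler_pM2l // ge_min lexx.
- move=> f w fE wf t ht; apply: le_lt_trans (H2 (f, w) fE wf t ht).
  by rewrite ge_min lexx orbT.
Qed.

Lemma middle_parts : exists (r : R) (M : G -> G -> set (R * R)) (q : G -> G -> R * R),
  [/\ 0 < r, forall x x' : G, x != x' -> 2 * r < `|p x - p x'|,
   forall x y, adj x y -> middle_part r x y (M x y, q x y, q y x) &
   forall x y w u, adj x y -> M x y u -> r <= `|u - p w|].
Proof.
have [r [r0 rV rE]] := vertex_radius.
have ex (a : G * G) : exists A, adj a.1 a.2 -> middle_part r a.1 a.2 A.
  case: (boolP (adj a.1 a.2)) => [xy|_]; last by exists (set0, 0, 0).
  by have [A HA] := middle_part_exists xy r0 (rV _ _ (adj_neq xy)); exists A.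
have [A HA] := choice ex.
(* One choice per edge, made for the orientation by rank, serves both directions, so that M and q
   agree for x y and y x. *)
pose fwd (x y : G) := (enum_rank x < enum_rank y)%N.
pose M (x y : G) := if fwd x y then (A (x, y)).1.1 else (A (y, x)).1.1.
pose q (x y : G) := if fwd x y then (A (x, y)).1.2 else (A (y, x)).2.
have P x y : adj x y -> middle_part r x y (M x y, q x y, q y x).
  move=> xy; rewrite /M /q /fwd; case: ltngtP => h.
  - by case: (A (x, y)) (HA (x, y) xy) => [[? ?] ?].
  - apply: middle_part_sym; have yx : adj y x by rewrite adj_sym.
    by case: (A (y, x)) (HA (y, x) yx) => [[? ?] ?].
  - by have := adj_neq xy; rewrite (enum_rank_inj (ord_inj h)) eqxx.
exists r, M, q; split => // x y w u xy Mu.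
have [h1 h2] := mid_far (P x y xy) Mu.
case: (boolP (w \in [set x; y]%SET)) => [|wf].
  by rewrite !inE => /orP[/eqP ->|/eqP ->].
have [t] := mid_arc (P x y xy) Mu; rewrite /= in_itv /= => /andP[t0 t1] <-.
by apply: ltW; apply: rE => //; [exact: edge_set2 | rewrite !ltW].
Qed.

Lemma compact_seg (a b : R * R) : compact (seg_pt a b @` `[0, 1]).
Proof.
apply: continuous_compact; last exact: segment_compact.
apply: continuous_subspaceT => t; rewrite (funext (seg_ptE a b)).
by apply: cvgD; [exact: cvg_cst | apply: cvgZr_tmp; exact: cvg_id].
Qed.

(** A radius joins [p x] to the extremity [q x y] of the middle part, which is itself replaced by a
    chain staying within d / 4 of it, where d bounds from below the gaps between pieces of distinct
    edges. *)
Lemma polygonal_drawing_exists : exists p' q chain,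
  polygonal_drawing (R := R) (@adj G) p' q chain.
Proof.
have [r [M [q [r0 rV P far]]]] := middle_parts.
have itv01 (s : R) : `[0, 1]%classic s <-> 0 <= s <= 1 by rewrite /= in_itv.
have qx x y : adj x y -> M x y (q x y) /\ `|q x y - p x| = r by move=> /P/mid_left.
have disj x y x' y' u : adj x y -> adj x' y' -> ~~ same_edge x y x' y' ->
    M x y u -> M x' y' u -> False.
  move=> xy xy' ns /(mid_arc (P x y xy)) h /(mid_arc (P x' y' xy')) h'.
  have : (gamma [set x; y]%SET @` `]0, 1[ `&` gamma [set x'; y']%SET @` `]0, 1[) u by [].
  rewrite (drawing_arc_arc D) ?edge_set2 //.
  by apply: contra ns; exact: set2_same_edge.
have rad x y s : adj x y -> 0 <= s <= 1 -> `|seg_pt (p x) (q x y) s - p x| = s * r.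
  move=> xy /andP[s0 _]; rewrite seg_ptE addrAC subrr add0r normrZ ger0_norm //.
  by have [_ ->] := qx x y xy.
have [||d0 d00 Hd0] := @finite_common_bound (G * G * (G * G))%type (fun a d =>
    adj a.1.1 a.1.2 -> adj a.2.1 a.2.2 -> ~~ same_edge a.1.1 a.1.2 a.2.1 a.2.2 ->
    (forall u v, M a.1.1 a.1.2 u -> M a.2.1 a.2.2 v -> d <= `|u - v|) /\
    (forall s v, 0 <= s <= 1 -> M a.2.1 a.2.2 v ->
       d <= `|seg_pt (p a.1.1) (q a.1.1 a.1.2) s - v|)).
- move=> [[x y] [x' y']] d d' /= _ le h xy xy' ns; have [h1 h2] := h xy xy' ns.
  by split=> [u v hu hv|s v hs hv]; apply: le_trans le _; [exact: h1|exact: h2].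
- move=> [[x y] [x' y']] /=.
  case: (boolP (adj x y)) => [xy|_]; last by exists 1.
  case: (boolP (adj x' y')) => [xy'|_]; last by exists 1.
  case: (boolP (same_edge x y x' y')) => [_|ns]; first by exists 1.
  have c1 := mid_compact (P x y xy); have c2 := mid_compact (P x' y' xy').
  have [|d1 d10 H1] := compact_gap c1 c2.
    by rewrite -subset0 => u [/= hu hv]; exact: (disj _ _ _ _ _ xy xy' ns hu hv).
  (* The radius reaches distance r from [p x] only at [q x y], which lies on the middle part of x y,
     hence not on that of x' y'. *)
  have [|d2 d20 H2] := compact_gap (@compact_seg (p x) (q x y)) c2.
    rewrite -subset0 => u [[s /itv01 hs <-]] /= hv; have := far _ _ x _ xy' hv.
    rewrite rad // -[X in X <= _]mul1r ler_pM2r // => s1'.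
    have /andP[_ s1] := hs.
    have s_1 : s = 1 by apply/eqP; rewrite eq_le s1.
    move: hv; rewrite s_1 seg_pt1 => hv; apply: (disj _ _ _ _ _ xy xy' ns _ hv).
    by have [] := qx x y xy.
  exists (Num.min d1 d2); split; first by rewrite lt_min d10.
  move=> _ _ _; split=> [u v hu hv|s v hs hv]; rewrite ge_min; apply/orP.
    by left; apply: H1.
  by right; apply: H2 => //; exists s => //; apply/itv01.
(* The bound by d0 separates distinct edges; the bound by r keeps the chains out of the boxes of
   radius r / 2. *)
pose d := Num.min d0 r.
have d_gt0 : 0 < d / 4 by rewrite divr_gt0 // lt_min d00.
have dd0 : d <= d0 by rewrite ge_min lexx.
have dr : d <= r by rewrite ge_min lexx orbT.
have exc (a : G * G) : exists l, adj a.1 a.2 -> last (q a.1 a.2) l = q a.2 a.1 /\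
    forall u v, (u, v) \in sides (q a.1 a.2) l -> M a.1 a.2 u /\ `|v - u| < d / 4.
  case: (boolP (adj a.1 a.2)) => [xy|_]; last by exists nil.
  by have [[l hl] _] := mid_linked (P _ _ xy) d_gt0; exists l.
have [c Hc] := choice exc; clearbody d.
have close x y u v t : adj x y -> (u, v) \in sides (q x y) (c (x, y)) -> 0 <= t <= 1 ->
    M x y u /\ `|seg_pt u v t - u| < d / 4.
  move=> xy uv /andP[t0 t1]; have [_ /(_ u v uv)[Mu h]] := Hc (x, y) xy; split=> //.
  rewrite seg_ptE addrAC subrr add0r normrZ ger0_norm //.
  by apply: le_lt_trans h; rewrite ler_piMl.
exists p, q, (fun x y => c (x, y)); split.
- by move=> x y xy; have [] := Hc (x, y) xy.
- move=> x y xy h; have [_] := qx x y xy.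
  by rewrite h subrr normr0 => E; rewrite E ltxx in r0.
(* All radii have length r, so s = t; if s were nonzero, [q x y] and [q x y'] would coincide and lie
   on two middle parts. *)
- move=> x y y' s t xy xy' yy' s0 t0 h1 h2.
  have E : s *: (q x y - p x) = t *: (q x y' - p x) by apply: injective_projections.
  have [Mq nq] := qx x y xy; have [Mq' nq'] := qx x y' xy'.
  have st : s = t.
    have := congr1 Num.norm E; rewrite !normrZ !ger0_norm // nq nq'.
    by move/(mulIf (lt0r_neq0 r0)).
  apply/eqP/negPn/negP => sn0; rewrite -st in E.
  have /addIr qq := scalerI sn0 E.
  apply: (disj x y x y' (q x y)) => //; last by rewrite qq.
  rewrite /same_edge eqxx (negPf yy') /= eq_sym; apply/negP => /andP[/eqP h _].
  by rewrite -h adj_irr in xy'.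
- move=> x y x' y' xy xy' xx [s [t [hs ht E]]].
  have := rV x x' xx; have h1 := rad x y s xy hs; have h2 := rad x' y' t xy' ht.
  have := ler_distD (seg_pt (p x) (q x y) s) (p x) (p x').
  rewrite [`|p x - seg_pt _ _ _|]distrC h1 E h2.
  move: hs ht => /andP[s0 s1] /andP[t0 t1].
  have : s * r <= r by rewrite ler_piMl // ltW.
  have : t * r <= r by rewrite ler_piMl // ltW.
  lra.
- move=> x y x' y' u v xy xy' ns uv [s [t [hs ht E]]].
  have [Mu h] := close x' y' u v t xy' uv ht.
  have [_ /(_ s u hs Mu)] := Hd0 (x, y, (x', y')) xy xy' ns.
  rewrite /= E; lra.
- move=> x y x' y' u v u' v' xy xy' ns uv uv' [s [t [hs ht E]]].
  have [Mu h] := close x y u v s xy uv hs.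
  have [Mu' h'] := close x' y' u' v' t xy' uv' ht.
  have [/(_ u u' Mu Mu') H _] := Hd0 (x, y, (x', y')) xy xy' ns.
  have {}H : d0 <= `|u - u'| := H.
  have {}h' : `|seg_pt u v s - u'| < d / 4 by rewrite E.
  have := ler_distD (seg_pt u v s) u u'.
  rewrite (distrC u (seg_pt u v s)); lra.
- exists (r / 2); first by rewrite divr_gt0.
  move=> x x' y' xy'; split.
    move=> u v uv s hs; rewrite in_boxE -leNgt.
    have [Mu h] := close x' y' u v s xy' uv hs; have := far x' y' x u xy' Mu.
    have := ler_distD (seg_pt u v s) u (p x); rewrite distrC in h; lra.
  move=> xx s hs; rewrite in_boxE -leNgt.
  have h1 := rV x x' xx; have h2 := rad x' y' s xy' hs.
  have := ler_distD (seg_pt (p x') (q x' y') s) (p x) (p x').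
  rewrite (distrC (p x) (seg_pt _ _ _)) h2.
  move: hs => /andP[s0 s1]; have : s * r <= r by rewrite ler_piMl // ltW.
  lra.
Qed.

End Assembly.

(** * Strong edge coloring *)

Lemma plane_drawing_subgraph (R : realType) (G : sgraph) (e : rel G) (e_sym : symmetric e)
    (e_irr : irreflexive e) (p : G -> R * R) gamma :
  subrel e (@adj G) -> plane_drawing p gamma ->
  @plane_drawing R (SGraph e_sym e_irr) p gamma.
Proof.
move=> sub D; set G' := SGraph e_sym e_irr.
have edge_sub f : f \in edges G' -> f \in edges G.
  rewrite !inE => /existsP[x /existsP[y /andP[xy fE]]].
  by apply/existsP; exists x; apply/existsP; exists y; rewrite (sub x y xy).
case: D => vi ac ai ae av aa; split=> //.
- by move=> f /edge_sub; exact: ac.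
- by move=> f /edge_sub; exact: ai.
- by move=> f /edge_sub; exact: ae.
- by move=> f /edge_sub; exact: av.
- by move=> f1 f2 /edge_sub h1 /edge_sub h2; exact: aa.
Qed.

Lemma planar_corner_system (R : realType) (G : sgraph) (e : rel G) :
  planar R G -> symmetric e -> subrel e (@adj G) -> exists C, corner_system e C.
Proof.
move=> [p [gamma D]] e_sym sub.
have e_irr : irreflexive e by move=> x; apply/negP => /sub; rewrite adj_irr.
have [p' [q [chain D']]] := polygonal_drawing_exists (plane_drawing_subgraph e_sym e_irr sub D).
exact: (corner_system_drawing (R := R) e_sym e_irr D').
Qed.

Section StrongColoring.
Variables (G : sgraph) (k N : nat) (phi : G -> {set 'I_k}).
Hypotheses (kE : k = N.*2.+1) (phiP : odd_coloring N (@adj G) phi).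

Let col0 : 'I_k.
Proof. by rewrite kE; exact: ord0. Qed.

(** On an edge exactly one of the 2N + 1 colours avoids two disjoint N-sets; [col0] serves only
    other vertex sets. *)
Definition missing_color (f : {set G}) : 'I_k :=
  odflt col0 [pick i | [forall x in f, i \notin phi x]].

Lemma missing_colorP (x y : G) (i : 'I_k) : adj x y ->
  (i == missing_color [set x; y]%SET) = (i \notin phi x) && (i \notin phi y).
Proof.
move=> xy; have [cphi dphi _] := phiP.
have card1 : #|~: (phi x :|: phi y)%SET| = 1%N.
  have := cardsC (phi x :|: phi y)%SET; rewrite cardsU disjoint_setI0 ?dphi // cards0 subn0.
  have k1 := kE; rewrite !cphi card_ord; lia.
have /cards1P[j jE] : #|~: (phi x :|: phi y)%SET| == 1%N by rewrite card1.
have mem l : (l == j) = (l \notin phi x) && (l \notin phi y).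
  by have /setP/(_ l) := jE; rewrite !inE negb_or => ->.
have all_mem l : [forall z in [set x; y]%SET, l \notin phi z] = (l == j).
  rewrite mem; apply/forall_inP/andP => [h|[h1 h2] z].
    by split; apply: h; rewrite !inE eqxx ?orbT.
  by rewrite !inE => /orP[/eqP ->|/eqP ->].
rewrite -mem /missing_color; case: pickP => [l|/(_ j)]; rewrite all_mem ?eqxx //.
by move=> /eqP ->.
Qed.

Lemma edgesP f : f \in edges G -> exists x y, adj x y /\ f = [set x; y]%SET.
Proof.
by rewrite inE => /existsP[x /existsP[y /andP[xy /eqP ->]]]; exists x, y.
Qed.

Lemma adjC (x y : G) : adj x y -> adj y x. Proof. by rewrite adj_sym. Qed.

Lemma setC2 (x y : G) : [set x; y]%SET = [set y; x]%SET.
Proof. by rewrite finset.setUC. Qed.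

(** [phi w] is the complement of [phi x] and the colour of x w, so local injectivity of [phi]
    separates the colours at x. *)
Lemma missing_color_inj (x y z : G) : adj x y -> adj x z ->
  missing_color [set x; y]%SET = missing_color [set x; z]%SET -> y = z.
Proof.
move=> xy xz E; have [cphi dphi inj] := phiP; apply: (inj x) => //.
have ext (w : G) : adj x w -> forall i, (i \in phi w) =
    (i \notin phi x) && (i != missing_color [set x; w]%SET).
  move=> xw i; rewrite missing_colorP // negb_and !negbK.
  case ix: (i \in phi x) => //=.
  by apply/negbTE/negP => iw; have /pred0P/(_ i) := dphi x w xw; rewrite /= ix iw.
by apply/setP => i; rewrite (ext y xy) (ext z xz) E.
Qed.

(* For a path u x y v, the colour of ux avoids phi x, hence lies in phi y
   unless it is the colour of xy; the colour of yv avoids phi y. *)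
Lemma missing_color_path (u x y v : G) : adj u x -> adj x y -> adj y v -> u != y ->
  missing_color [set u; x]%SET != missing_color [set y; v]%SET.
Proof.
move=> ux xy yv uy; have xu := adjC ux; rewrite setC2.
apply/negP => /eqP E; set i := missing_color _ in E.
have /andP[ix _] : (i \notin phi x) && (i \notin phi u) by rewrite -missing_colorP.
have /andP[iy _] : (i \notin phi y) && (i \notin phi v) by rewrite -missing_colorP // E.
have : i == missing_color [set x; y]%SET by rewrite missing_colorP // ix.
by move=> /eqP /(missing_color_inj xu xy) h; rewrite h eqxx in uy.
Qed.

Lemma edge_at f (x : G) : f \in edges G -> x \in f -> exists2 y, adj x y & f = [set x; y]%SET.
Proof.
move=> /edgesP[u [v [uv ->]]]; rewrite !inE => /orP[/eqP ->|/eqP ->]; first by exists v.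
by exists u; [exact: adjC | exact: setC2].
Qed.

Lemma missing_color_proper : proper_edge_coloring missing_color.
Proof.
move=> f1 f2 E1 E2 ne; rewrite -setI_eq0 => /set0Pn[x]; rewrite inE => /andP[x1 x2].
have [y xy f1E] := edge_at E1 x1; have [z xz f2E] := edge_at E2 x2.
apply: contraNneq ne; rewrite f1E f2E => /(missing_color_inj xy xz) ->.
exact: eqxx.
Qed.

(** An edge x y spanned by the class of i meets edges x u and y v of colour i. If u = y it is in the
    class; otherwise u x y v contradicts [missing_color_path]. *)
Lemma missing_color_strong : strong_edge_coloring missing_color.
Proof.
split; first exact: missing_color_proper.
move=> i; set M := [set f in edges G | _]%SET.
have MP f : f \in M -> f \in edges G /\ missing_color f = i.
  by rewrite inE => /andP[h /eqP].
split; first split.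
- by apply/fintype.subsetP => f /MP[].
- apply/finset.trivIsetP => f1 f2 /MP[E1 c1] /MP[E2 c2] ne.
  apply: contraT => nd; have := missing_color_proper E1 E2 ne nd.
  by rewrite c1 c2 eqxx.
- move=> f fE /fintype.subsetP fM; have [x [y [xy fxy]]] := edgesP fE.
  have [xf yf] : x \in f /\ y \in f by rewrite fxy !inE !eqxx orbT.
  have /finset.bigcupP[f1 f1M xf1] := fM x xf; have /finset.bigcupP[f2 f2M yf2] := fM y yf.
  have [E1 c1] := MP f1 f1M; have [E2 c2] := MP f2 f2M.
  have [u xu f1E] := edge_at E1 xf1; have [v yv f2E] := edge_at E2 yf2.
  case: (eqVneq u y) => [uy|uy]; first by rewrite fxy -uy -f1E.
  have := missing_color_path (adjC xu) xy yv uy.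
  by rewrite setC2 -f1E -f2E c1 c2 eqxx.
Qed.

End StrongColoring.

Theorem theorem3p2 (R : realType) (Delta : nat) (hDelta : 4 <= Delta)
  (G : sgraph) (planarG : planar R G) (degG : max_degree G <= Delta)
  (girthG : (((10 * Delta - 4)%N%:R)%:E <= girth R G)%E) :
  exists c : {set G} -> 'I_(2 * Delta - 1), strong_edge_coloring c.
Proof.
(* In terms of N there are 2N + 1 colours, 3 <= N, and the girth bound 10 Delta - 4 reads 10N +
   6. *)
pose N := Delta.-1.
have kE : 2 * Delta - 1 = N.*2.+1 by rewrite /N; lia.
have [|||||||phi phiP] := @odd_coloring_exists G 'I_(2 * Delta - 1) N (@adj G).
- by rewrite card_ord.
- by rewrite /N; lia.
- exact: adj_sym.
- exact: adj_irr.
- move=> x; have -> : N.+1 = Delta by rewrite /N; lia.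
  apply: leq_trans degG; rewrite /max_degree /deg.
  exact: (leq_bigmax x).
- move=> c uc sc; have : (girth R G <= ((size c)%:R)%:E)%E.
    by apply: ereal_inf_lbound; exists c.
  move=> /(le_trans girthG); rewrite lee_fin ler_nat; rewrite /N; lia.
- by move=> e e_sym sub; exact: planar_corner_system planarG e_sym sub.
by exists (missing_color phi kE); exact: missing_color_strong phiP.
Qed.
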